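(* For every integer $r \geq 3$, all $\alpha>0$ and $\varepsilon>0$, and all sufficiently large $n$, there exists an $n$-vertex graph $G$ with minimum degree at least $\left(\frac{2r-5}{2r-3}- \alpha\right)n$ and with at most $\frac{\alpha^3}{(r/3)^r} \delta \left( \frac{(2r-3)^2}{\alpha^2}\varepsilon, K_3 \right) n^r$ copies of $K_r$, such that at least $\varepsilon n^2$ edges must be deleted from $G$ to make it $K_r$-free. Consequently, \[ \delta\left(\varepsilon,K_r;\frac{2r-5}{2r-3}- \alpha\right) \leq \frac{\alpha^3}{(r/3)^r} \delta \left( \frac{(2r-3)^2}{\alpha^2}\varepsilon, K_3 \right). \]
   Context: For a graph $H$ on $h$ vertices, $\varepsilon>0$ and real $\gamma$, $\delta(\varepsilon,H;\gamma)$ denotes the maximum $\delta\in[0,1]$ such that, for every $n$, every $n$-vertex graph with fewer than $\delta n^h$ copies of $H$ (subgraphs isomorphic to $H$) and minimum degree at least $\gamma n$ can be made $H$-free by deleting at most $\varepsilon n^2$ edges. Also $\delta(\varepsilon,H)=\delta(\varepsilon,H;0)$. $K_r$ is the complete graph on $r$ vertices.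
   Formalization: The formal statement assumes α ≤ 1 and (2r−3)²ε/α² < 1; for all α, ε > 0 the claim is false (for ε ≥ 1/2 no n-vertex graph has εn² edges to delete). Excluded cases have negative degree threshold or δ(·,K₃) = 1. *)

(* Defs.v *)
From mathcomp Require Import classical_sets reals.
From mathcomp Require Import all_boot all_order all_algebra.

Set Implicit Arguments.
Unset Strict Implicit.
Unset Printing Implicit Defensive.

Import Order.TTheory GRing.Theory Num.Theory.

Local Open Scope ring_scope.

(* A finite simple graph on V is given by its edges, which are 2-element sets
   of vertices. *)
Record sgraph (V : finType) := SGraph {
  edges : {set {set V}};
  edgesP : [forall e in edges, #|e| == 2%N] }.

Section Graphs.

Variable V : finType.
Implicit Types (G : sgraph V) (D : {set {set V}}).

Fact complete_subproof :
  [forall e in [set e : {set V} | #|e| == 2%N], #|e| == 2%N].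
Proof. by apply/forall_inP => e; rewrite inE. Qed.

Definition complete : sgraph V := SGraph complete_subproof.

Fact del_edges_subproof G D : [forall e in edges G :\: D, #|e| == 2%N].
Proof.
apply/forall_inP => e; rewrite inE => /andP[_].
by move/forall_inP: (edgesP G); apply.
Qed.

Definition del_edges G D : sgraph V := SGraph (del_edges_subproof G D).

Definition deg G (v : V) : nat := #|[set e in edges G | v \in e]|.

Definition min_deg_ge (R : realType) G (x : R) : Prop :=
  forall v : V, x <= (deg G v)%:R.

End Graphs.

Notation "''K_' r" := (complete 'I_r) (at level 8, r at level 2, format "''K_' r").

Section Copies.

Variables (W V : finType) (H : sgraph W).
Implicit Types (G : sgraph V) (p : {set V} * {set {set V}}).

(* A pair p stands for the graph with vertex set p.1 and edge set p.2. *)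
Definition is_subgraph p G : bool :=
  (p.2 \subset edges G) && [forall e in p.2, e \subset p.1].

Definition isomorphic_to p : bool :=
  [exists f : {ffun W -> V},
    [&& injectiveb f, p.1 == [set f x | x : W]
      & p.2 == [set f @: e | e : {set W} in edges H]]].

(* Unlabelled copies: each subgraph of G isomorphic to H is counted once. *)
Definition copies G : {set {set V} * {set {set V}}} :=
  [set p | is_subgraph p G && isomorphic_to p].

Definition H_free G : bool := copies G == set0.

Definition deletable_within (R : realType) G (x : R) : Prop :=
  exists D : {set {set V}},
    [/\ D \subset edges G, #|D|%:R <= x & H_free (del_edges G D)].

Definition must_delete_at_least (R : realType) G (x : R) : Prop :=
  forall D : {set {set V}},
    D \subset edges G -> H_free (del_edges G D) -> x <= #|D|%:R.

End Copies.

Section Delta.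

Variables (R : realType) (W : finType).
Implicit Types (eps gamma d : R) (H : sgraph W).

Definition delta_admissible eps H gamma d : Prop :=
  forall (n : nat) (G : sgraph 'I_n),
    #|copies H G|%:R < d * n%:R ^+ #|W| ->
    min_deg_ge G (gamma * n%:R) ->
    deletable_within H G (eps * n%:R ^+ 2).

(* The supremum is a maximum, see delta_max. *)
Definition delta eps H gamma : R :=
  sup [set d : R | 0 <= d <= 1 /\ delta_admissible eps H gamma d]%classic.

Lemma delta_max eps H gamma :
  [/\ 0 <= delta eps H gamma <= 1,
      delta_admissible eps H gamma (delta eps H gamma)
    & forall d, 0 <= d <= 1 -> delta_admissible eps H gamma d ->
        d <= delta eps H gamma].
Proof.
rewrite /delta; set S := [set d : R | _]%classic.
have S0 : S 0.
  split; first by rewrite lexx ler01.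
  by move=> n G; rewrite mul0r ltNge ler0n.
have hS : has_sup S.
  by split; [exists 0 | exists 1 => d [/andP[_ ->]]].
have ubS d : S d -> d <= sup S by exact: ub_le_sup (proj2 hS) d.
have sup1 : 0 <= sup S <= 1.
  rewrite ubS //=; apply: ge_sup; first by exists 0.
  by move=> d [/andP[_ ->]].
split=> // [n G lt_cp hdeg|d d01 hd]; last exact: ubS.
have [n0|n0] := eqVneq (n%:R ^+ #|W| : R) 0.
  by move: lt_cp; rewrite n0 mulr0 ltNge ler0n.
have np : 0 < (n%:R ^+ #|W| : R) by rewrite lt_def n0 exprn_ge0 // ler0n.
have /(sup_adherent)/(_ hS)[d Sd] :
    0 < sup S - #|copies H G|%:R / n%:R ^+ #|W|.
  by rewrite subr_gt0 ltr_pdivrMr.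
rewrite subKr ltr_pdivrMr // => lt_d.
by case: Sd => _ /(_ n G lt_d hdeg).
Qed.

End Delta.

(* Main.v *)
(** Lower bound construction.  Split the vertices into 2r - 3 units of size
    n / (2r - 3).  Three units are the pairs A_i, B_i (i < 3), where A_i is an
    alpha-fraction of its unit, joined to B_i only; B_0 is joined to B_1 and B_2;
    the other 2(r - 3) units form r - 3 independent sets W_j joined to everything
    else.  Between A_0, A_1, A_2 sits a blow-up of the tripartite double cover of a
    graph that is far from triangle-free but has few triangles.  The graph has a
    proper r-colouring in which every r-clique consists of a triangle in A_0, A_1,
    A_2 and one vertex of each W_j, and destroying all r-cliques is as expensive as
    destroying all triangles of the blow-up, because the W_j are larger than the A_i.

    The bound is stated for delta itself, so delta(E, K_3) > 0, the triangle removal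
    lemma, is unavoidable.  It is proved by an energy increment giving a partition
    that is regular in the cut norm on most pairs; no equipartition is needed. *)

Require Import Defs.
From mathcomp Require Import boolp reals.
From mathcomp Require Import all_boot all_order all_algebra.
From mathcomp Require Import ring lra.

Set Implicit Arguments.
Unset Strict Implicit.
Unset Printing Implicit Defensive.

Import Order.TTheory GRing.Theory Num.Theory.
Local Open Scope ring_scope.

(** * Energy of a partition *)

Section Averaging.

Variables (R : realFieldType) (P : finType) (F : P -> R).

(** Conditional expectation of [F] given the colouring [C]; an empty fibre gets 0, the value of
    division by 0. *)
Definition dens (T : eqType) (C : P -> T) (t : T) : R :=
  (\sum_(q | C q == t) F q) / #|[pred q | C q == t]|%:R.

Lemma fiber_gt0 (T : eqType) (C : P -> T) p : (0 : R) < #|[pred q | C q == C p]|%:R.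
Proof. by rewrite ltr0n; apply/card_gt0P; exists p; rewrite inE. Qed.

Lemma dens_mulr (T : eqType) (C : P -> T) t :
  dens C t * #|[pred q | C q == t]|%:R = \sum_(q | C q == t) F q.
Proof.
have [z|nz] := eqVneq #|[pred q | C q == t]| 0%N.
  rewrite z mulr0 big1 // => q Cq.
  by have /card0_eq/(_ q) := z; rewrite inE Cq.
by rewrite /dens divfK // pnatr_eq0.
Qed.

(** Averaging over fibres is self-adjoint: expand the average into a double sum and swap. Each
    [f q * F q] then occurs once per point of its fibre, which cancels the denominator. *)
Lemma sum_dens (T : eqType) (C : P -> T) (f : P -> R) :
  (forall p q, C p = C q -> f p = f q) ->
  \sum_p f p * dens C (C p) = \sum_p f p * F p.
Proof.
move=> fC.
transitivity (\sum_p \sum_(q | C q == C p) f q * F q / #|[pred x | C x == C q]|%:R).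
  apply: eq_bigr => p _; rewrite /dens mulrA mulr_sumr mulr_suml.
  by apply: eq_bigr => q /eqP Cq; rewrite Cq (fC p q).
rewrite (exchange_big_dep predT) //=; apply: eq_bigr => q _.
rewrite (eq_bigl (fun p => p \in [pred x | C x == C q])); last first.
  by move=> p; rewrite inE eq_sym.
rewrite sumr_const -[LHS]mulr_natr divfK //.
by rewrite gt_eqF // fiber_gt0.
Qed.

End Averaging.

Section Energy.

Variables (R : realFieldType) (P : finType) (F : P -> R).
Hypothesis F01 : forall p, 0 <= F p <= 1.

Lemma dens01 (T : eqType) (C : P -> T) t : 0 <= dens F C t <= 1.
Proof.
have F0 p : 0 <= F p by case/andP: (F01 p).
have [z|nz] := eqVneq #|[pred q | C q == t]| 0%N.
  by rewrite /dens z invr0 mulr0 lexx ler01.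
rewrite divr_ge0 ?sumr_ge0 //= ler_pdivrMr ?ltr0n ?lt0n // mul1r.
rewrite -sumr_const; apply: ler_sum => q _; by case/andP: (F01 q).
Qed.

Definition energy (T : eqType) (C : P -> T) : R := \sum_p dens F C (C p) ^+ 2.

Lemma energy_le (T : eqType) (C : P -> T) : energy C <= #|P|%:R.
Proof.
rewrite -sumr_const; apply: ler_sum => p _; case/andP: (dens01 C (C p)) => h0 h1.
exact: exprn_ile1.
Qed.

(** Pythagoras: the coarse averages are the projection of the fine ones, so the cross term equals
    [energy C]. *)
Lemma energy_refine (T T' : eqType) (C : P -> T) (C' : P -> T') :
  (forall p q, C' p = C' q -> C p = C q) ->
  energy C' = energy C + \sum_p (dens F C' (C' p) - dens F C (C p)) ^+ 2.
Proof.
move=> ref.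
have h1 : \sum_p dens F C (C p) * dens F C' (C' p) = \sum_p dens F C (C p) * F p.
  by apply: sum_dens => p q /ref ->.
have h2 : energy C = \sum_p dens F C (C p) * F p.
  by rewrite -(@sum_dens R P F T C (fun p => dens F C (C p))) // => p q ->.
rewrite [X in _ + X](eq_bigr (fun p => dens F C' (C' p) ^+ 2
   - 2 * (dens F C (C p) * dens F C' (C' p)) + dens F C (C p) ^+ 2)); last first.
  by move=> p _; ring.
rewrite big_split sumrB /= -mulr_sumr h1 -/(energy C) -/(energy C') h2; ring.
Qed.

(** Cauchy-Schwarz, by expanding the sum of [(m * g i - s) ^+ 2] and cancelling a factor [m]. *)
Lemma sum_sqr_le (I : finType) (S : pred I) (g : I -> R) :
  (\sum_(i | S i) g i) ^+ 2 <= #|S|%:R * \sum_(i | S i) g i ^+ 2.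
Proof.
set s := \sum_(i | S i) g i; set m : R := #|S|%:R; set e := \sum_(i | S i) _.
have m0 : 0 <= m by rewrite ler0n.
have : 0 <= \sum_(i | S i) (m * g i - s) ^+ 2 by apply: sumr_ge0 => i _; rewrite sqr_ge0.
rewrite (eq_bigr (fun i => m ^+ 2 * g i ^+ 2 - (2 * m * s) * g i + s ^+ 2)); last first.
  by move=> i _; ring.
rewrite big_split sumrB /= -!mulr_sumr sumr_const -/s -/e -mulr_natr -/m => h.
have {h}h : 0 <= m * (m * e - s ^+ 2) by move: h; lra.
have [z|nz] := eqVneq #|S| 0%N.
  have -> : s = 0.
    rewrite /s big1 // => i Si.
    by have /card0_eq/(_ i) := z; rewrite unfold_in Si.
  by rewrite expr0n /= mulr_ge0 // sumr_ge0 // => i _; rewrite sqr_ge0.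
have mp : 0 < m by rewrite ltr0n lt0n.
by rewrite (pmulr_rge0 _ mp) subr_ge0 in h.
Qed.

(** The gain is the squared distance between fine and coarse densities. On an irregular fibre of
    size [n] their difference, summed over the witness set [S], exceeds [eps * n] in absolute value,
    so by Cauchy-Schwarz its mean square is at least [eps ^+ 2]; irregular fibres cover an [eps]
    fraction of [P]. *)
Lemma energy_incr (T T' : eqType) (C : P -> T) (C' : P -> T') (eps : R)
    (S : T -> pred P) (irr : pred P) :
  0 < eps ->
  (forall p q, C' p = C' q -> C p = C q) ->
  (forall t p q, C' p = C' q -> S t p = S t q) ->
  (forall p, irr p ->
    eps * #|[pred q | C q == C p]|%:R <
    `|\sum_(q | (C q == C p) && S (C p) q) (F q - dens F C (C p))|) ->
  eps * #|P|%:R <= #|irr|%:R ->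
  energy C + eps ^+ 3 * #|P|%:R <= energy C'.
Proof.
move=> eps0 ref Sm hirr many.
rewrite (energy_refine ref) lerD2l.
set g := fun p => dens F C' (C' p) - dens F C (C p).
have -> : \sum_p (dens F C' (C' p) - dens F C (C p)) ^+ 2 =
    \sum_p dens (fun q => g q ^+ 2) C (C p).
  have := @sum_dens R P (fun q => g q ^+ 2) T C (fun=> 1) (fun _ _ _ => erefl).
  by under eq_bigr do rewrite mul1r; under [in RHS]eq_bigr do rewrite mul1r; move=> ->.
have dens_ge0 p : 0 <= dens (fun q => g q ^+ 2) C (C p).
  by rewrite /dens divr_ge0 // sumr_ge0 // => q _; rewrite sqr_ge0.
apply: (@le_trans _ _ (\sum_(p | irr p) eps ^+ 2)).
  rewrite sumr_const -[leRHS]mulr_natr exprSr -mulrA ler_wpM2l //.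
  by rewrite exprn_ge0 // ltW.
rewrite [leRHS](bigID irr) /= -[leLHS]addr0 lerD ?sumr_ge0 //.
apply: ler_sum => p /hirr.
set n : R := #|_|%:R.
have n0 : 0 < n by apply: fiber_gt0.
(* The witness set is a union of fibres of [C'], so [F] may be replaced there by its average over
   [C']. *)
have -> : \sum_(q | (C q == C p) && S (C p) q) (F q - dens F C (C p)) =
   \sum_(q | (C q == C p) && S (C p) q) g q.
  have := @sum_dens R P F T' C' (fun q => ((C q == C p) && S (C p) q)%:R) _.
  have hm q q' : C' q = C' q' ->
     ((C q == C p) && S (C p) q)%:R = ((C q' == C p) && S (C p) q')%:R :> R.
    by move=> e; rewrite (ref _ _ e) (Sm _ _ _ e).
  move=> /(_ hm) h.
  have conv (f : P -> R) : \sum_q ((C q == C p) && S (C p) q)%:R * f q =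
      \sum_(q | (C q == C p) && S (C p) q) f q.
    by rewrite [RHS]big_mkcond; apply: eq_bigr => q _; case: ifP; rewrite ?mul1r ?mul0r.
  rewrite !conv in h.
  rewrite sumrB -h -sumrB; apply: eq_bigr => q /andP[/eqP Cq _].
  by rewrite /g Cq.
set s := \sum_(q | _) _ => lts.
have : (eps * n) ^+ 2 <= s ^+ 2.
  rewrite -[leRHS]real_normK ?num_real // lerXn2r ?nnegrE ?normr_ge0 ?mulr_ge0 ?ltW //.
move=> /le_trans/(_ (sum_sqr_le _ _)) h.
rewrite /dens ler_pdivlMr // -/n.
have h2 : #|(fun q => (C q == C p) && S (C p) q)|%:R <= n.
  rewrite ler_nat; apply: subset_leq_card; apply/subsetP => q; rewrite !inE.
  by rewrite unfold_in => /andP[].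
have h3 : \sum_(q | (C q == C p) && S (C p) q) g q ^+ 2 <= \sum_(q | C q == C p) g q ^+ 2.
  rewrite [leRHS](bigID (S (C p))) /= lerDl sumr_ge0 // => q _; exact: sqr_ge0.
have : (eps * n) ^+ 2 <= n * \sum_(q | C q == C p) g q ^+ 2.
  apply: (le_trans h); apply: ler_pM => //.
  by apply: sumr_ge0 => q _; exact: sqr_ge0.
by rewrite exprMn [n ^+ 2]expr2 mulrA mulrC ler_pM2l.
Qed.

End Energy.

(** * Cut regularity *)

Section Regularity.

Variables (R : realFieldType) (V : finType) (a : rel V) (eps : R).
Hypothesis eps_gt0 : 0 < eps.

Definition adj (p : V * V) : R := (a p.1 p.2)%:R.

Lemma adj01 p : 0 <= adj p <= 1.
Proof. by rewrite /adj; case: (a _ _); rewrite /= ?lexx ler01. Qed.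

Definition col2 (T : finType) (c : V -> T) (p : V * V) : T * T := (c p.1, c p.2).

Definition discrepancy (T : finType) (c : V -> T) (t : T * T) (XY : {set V} * {set V}) : R :=
  \sum_(q | (col2 c q == t) && ((q.1 \in XY.1) && (q.2 \in XY.2)))
     (adj q - dens adj (col2 c) t).

(** The deviation is compared with the whole cell and not with the box spanned by the witness sets,
    as in the cut norm. *)
Definition cut_witness (T : finType) (c : V -> T) (t : T * T) (XY : {set V} * {set V}) : bool :=
  eps * #|[pred q | col2 c q == t]|%:R < `|discrepancy c t XY|.

Definition cut_irregular (T : finType) (c : V -> T) (t : T * T) : bool :=
  [exists XY, cut_witness c t XY].

(** Irregular cells are weighted by the vertex pairs they contain, so parts may differ widely in
    size. *)
Definition cut_regular (T : finType) (c : V -> T) : bool :=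
  #|[pred p | cut_irregular c (col2 c p)]|%:R <= eps * #|{: V * V}|%:R.

(** The new colour of a vertex also records, for every cell, which of its two witness sets contain
    the vertex; all witness sets become unions of classes and [energy_incr] applies. *)
Lemma cut_regular_step (T : finType) (c : V -> T) :
  ~~ cut_regular c ->
  exists (T' : finType) (c' : V -> T'),
    (#|T'| <= #|T| * 2 ^ (#|T| * #|T|) * 2 ^ (#|T| * #|T|))%N /\
    energy adj (col2 c) + eps ^+ 3 * #|{: V * V}|%:R <= energy adj (col2 c').
Proof.
rewrite /cut_regular -ltNge => many.
pose W t := odflt (set0, set0) [pick XY | cut_witness c t XY].
pose c' v := (c v, [set t | v \in (W t).1], [set t | v \in (W t).2]).
exists (T * {set T * T} * {set T * T})%type, c'; split.
  by rewrite !card_prod -!cardsT -!powersetT !card_powerset !cardsT !card_prod.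
apply: (@energy_incr R _ adj _ _ (col2 c) (col2 c') eps
   (fun t => [pred q | (q.1 \in (W t).1) && (q.2 \in (W t).2)])
   [pred p | cut_irregular c (col2 c p)]) => //.
- by move=> [p1 p2] [q1 q2] [] e1 _ _ e2 _ _; rewrite /col2 /= e1 e2.
- move=> t [p1 p2] [q1 q2] [] _ /setP/(_ t) e1 _ _ _ /setP/(_ t) e2.
  by move: e1 e2; rewrite !inE /= => -> ->.
- move=> p /existsP[XY wXY].
  have : cut_witness c (col2 c p) (W (col2 c p)).
    by rewrite /W; case: pickP => [//|/(_ XY)]; rewrite wXY.
  by [].
- exact: ltW.
Qed.

End Regularity.

(** Bound on the number of colours after [k] refinements, each adding two sets of cells to a
    colour. *)
Fixpoint tower (k : nat) : nat :=
  if k is k'.+1 then tower k' * 2 ^ (tower k' * tower k') * 2 ^ (tower k' * tower k') else 1.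

Lemma cut_regularity_iter (R : realFieldType) (eps : R) (k : nat) (V : finType) (a : rel V) :
  0 < eps ->
  exists (T : finType) (c : V -> T), (#|T| <= tower k)%N /\
    (cut_regular a eps c \/
     k%:R * (eps ^+ 3 * #|{: V * V}|%:R) <= energy (@adj R V a) (col2 c)).
Proof.
move=> eps0; elim: k => [|k [T [c [leT IH]]]].
  exists unit, (fun=> tt); split; first by rewrite card_unit.
  by right; rewrite mul0r sumr_ge0 // => p _; rewrite sqr_ge0.
have [reg|nreg] := boolP (cut_regular a eps c).
  exists T, c; split; last by left.
  by rewrite (leq_trans leT) //= -mulnA leq_pmulr // muln_gt0 !expn_gt0.
have [T' [c' [leT' e]]] := cut_regular_step eps0 nreg.
exists T', c'; split.
  apply: (leq_trans leT').
  by rewrite /= !leq_mul // leq_pexp2l // leq_mul.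
right; case: IH => [reg|IH]; first by rewrite reg in nreg.
apply: le_trans e; rewrite -natr1 mulrDl mul1r; exact: lerD.
Qed.

(** The energy is at most the number of vertex pairs, so more than [eps ^- 3] increments are
    impossible unless there are no vertices. *)
Lemma cut_regularity (R : realType) (eps : R) : 0 < eps ->
  exists K : nat, forall (V : finType) (a : rel V),
  exists (T : finType) (c : V -> T), (#|T| <= K)%N /\ cut_regular a eps c.
Proof.
move=> eps0; pose k := (Num.truncn (eps ^- 3)).+1.
exists (tower k) => V a.
have [T [c [leT [reg|h]]]] := cut_regularity_iter k a eps0; first by exists T, c.
exists T, c; split=> //.
have h1 := le_trans h (energy_le (adj01 R a) (col2 c)).
have k1 : 1 < k%:R * eps ^+ 3.
  by rewrite -ltr_pdivrMr ?exprn_gt0 // div1r truncnS_gt.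
have n0 : #|{: V * V}| = 0%N.
  apply/eqP; rewrite -leqn0 leqNgt; apply/negP => n0.
  move: h1; rewrite mulrA leNgt -[X in X < _]mul1r ltr_pM2r ?k1 //.
  by rewrite ltr0n.
rewrite /cut_regular n0 mulr0.
have := max_card [pred p | cut_irregular a eps c (col2 c p)].
by rewrite n0 leqn0 => /eqP ->.
Qed.

(** * Triangle removal *)

(** [a] is any relation, so these are ordered triples with arcs from first to second, second to
    third and first to third, loops allowed. *)
Definition triangles (V : finType) (a : rel V) : {set V * V * V} :=
  [set p | [&& a p.1.1 p.1.2, a p.1.2 p.2 & a p.1.1 p.2]].

Section Counting.

Variables (R : realFieldType) (V : finType) (a : rel V) (eps : R).
Variables (T : finType) (c : V -> T).
Hypothesis eps_gt0 : 0 < eps.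

Let A x y : R := (a x y)%:R.
Let d i j : R := dens (@adj R V a) (col2 c) (i, j).
Let N i : R := #|[pred x | c x == i]|%:R.

Lemma card_col2 i j :
  #|[pred q | col2 c q == (i, j)]|%:R = N i * N j.
Proof.
by rewrite -natrM -cardX; congr _%:R.
Qed.

Lemma sum_cell (f : V -> V -> R) i j :
  \sum_(x | c x == i) \sum_(y | c y == j) f x y =
  \sum_(q | col2 c q == (i, j)) f q.1 q.2.
Proof.
rewrite pair_big; apply: eq_bigl => -[x y].
by rewrite /col2 /= xpair_eqE.
Qed.

Lemma weighted_discrepancy i j (u v : pred V) :
  ~~ cut_irregular a eps c (i, j) ->
  - (eps * (N i * N j)) <=
  \sum_(x | c x == i) \sum_(y | c y == j) (A x y - d i j) * ((u x)%:R * (v y)%:R).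
Proof.
move/existsPn/(_ ([set x | u x], [set y | v y])).
rewrite /cut_witness -leNgt card_col2 ler_norml => /andP[h _].
apply: (le_trans h); rewrite le_eqVlt; apply/orP; left; apply/eqP.
rewrite sum_cell /discrepancy big_mkcondr; apply: eq_bigr => q _ /=.
by rewrite !inE; case: (u _); case: (v _); rewrite /= ?mulr1 ?mulr0.
Qed.

(** Adjacency factors are replaced by densities one at a time: [x y] with [z] fixed, then [y z] with
    [x] fixed, each at a cost of at most [eps] times the number of triples. The last factor sums
    exactly to its density. *)
Lemma triangle_counting i j k :
  ~~ cut_irregular a eps c (i, j) -> ~~ cut_irregular a eps c (j, k) ->
  (d i j * d j k * d i k - 2 * eps) * (N i * N j * N k) <= #|triangles a|%:R.
Proof.
move=> rij rjk.
have N0 t : 0 <= N t by rewrite ler0n.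
have d01 t t' : 0 <= d t t' <= 1.
  by exact: (dens01 (adj01 R a) (col2 c) (t, t')).
set M := N i * N j * N k.
have M0 : 0 <= M by rewrite !mulr_ge0.
pose S1 := \sum_(x | c x == i) \sum_(y | c y == j) \sum_(z | c z == k) A x y * (A y z * A x z).
pose S2 := \sum_(x | c x == i) \sum_(y | c y == j) \sum_(z | c z == k) A y z * A x z.
pose S3 := \sum_(x | c x == i) \sum_(y | c y == j) \sum_(z | c z == k) A x z.
have h3 : S3 = d i k * M.
  rewrite /S3; transitivity (\sum_(x | c x == i) N j * (\sum_(z | c z == k) A x z)).
    by apply: eq_bigr => x _; rewrite sumr_const mulr_natl.
  rewrite -mulr_sumr sum_cell -(@dens_mulr R _ (@adj R V a) _ (col2 c) (i, k)) card_col2.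
  rewrite -/(d i k) /M; ring.
have h2 : d j k * S3 - eps * M <= S2.
  suff : - (eps * M) <= S2 - d j k * S3 by lra.
  have -> : S2 - d j k * S3 = \sum_(x | c x == i) \sum_(y | c y == j) \sum_(z | c z == k)
      (A y z - d j k) * (true%:R * A x z).
    rewrite /S2 /S3 mulr_sumr -sumrB; apply: eq_bigr => x _.
    rewrite mulr_sumr -sumrB; apply: eq_bigr => y _.
    rewrite mulr_sumr -sumrB; apply: eq_bigr => z _; rewrite mul1r; ring.
  have -> : - (eps * M) = \sum_(x | c x == i) - (eps * (N j * N k)).
    by rewrite sumr_const -[RHS]mulr_natr -/(N i) /M; ring.
  apply: ler_sum => x _.
  exact: (weighted_discrepancy (fun=> true) (fun z => a x z)).
have h1 : d i j * S2 - eps * M <= S1.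
  have e1 : S1 - d i j * S2 = \sum_(x | c x == i) \sum_(y | c y == j) \sum_(z | c z == k)
      (A x y - d i j) * (A x z * A y z).
    rewrite /S2 /S1 mulr_sumr -sumrB; apply: eq_bigr => x _.
    rewrite mulr_sumr -sumrB; apply: eq_bigr => y _.
    rewrite mulr_sumr -sumrB; apply: eq_bigr => z _; ring.
  (* With [z] outermost, the other two factors are indicators in [x] and in [y], as
     [weighted_discrepancy] requires. *)
  have e2 : S1 - d i j * S2 = \sum_(z | c z == k) \sum_(x | c x == i) \sum_(y | c y == j)
      (A x y - d i j) * (A x z * A y z).
    by rewrite e1 [RHS]exchange_big /=; apply: eq_bigr => x _; rewrite exchange_big.
  suff : - (eps * M) <= S1 - d i j * S2 by lra.
  rewrite e2.
  have -> : - (eps * M) = \sum_(z | c z == k) - (eps * (N i * N j)).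
    by rewrite sumr_const -[RHS]mulr_natr -/(N k) /M; ring.
  apply: ler_sum => z _.
  exact: (weighted_discrepancy (fun x => a x z) (fun y => a y z)).
have h0 : S1 <= #|triangles a|%:R.
  rewrite /S1.
  under eq_bigr do rewrite pair_big /=.
  rewrite pair_big /= -sum1_card natr_sum [leRHS]big_mkcond.
  rewrite (reindex (fun p : V * V * V => (p.1.1, (p.1.2, p.2)))) /=; last first.
    apply: onW_bij; exists (fun p : V * (V * V) => (p.1, p.2.1, p.2.2)).
      by case=> [[]].
    by case=> ? [].
  rewrite [leLHS]big_mkcond; apply: ler_sum => -[[x y] z] _ /=.
  rewrite inE /= /A -!natrM -/(1%:R).
  by case: ifP => _; case: (a x y); case: (a y z); case: (a x z);
    rewrite /= ?mul0n ?mul1n ?lexx ?ler01.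
have /andP[dij0 dij1] := d01 i j; have /andP[djk0 djk1] := d01 j k.
have /andP[dik0 dik1] := d01 i k.
apply: le_trans h0; apply: le_trans h1.
have : d i j * (d j k * S3 - eps * M) <= d i j * S2 by rewrite ler_wpM2l.
have : d i j * (eps * M) <= eps * M.
  by rewrite ler_piMl // mulr_ge0 // ltW.
rewrite h3; nra.
Qed.

End Counting.

Lemma sum_small_fibers (R : realFieldType) (V T : finType) (c : V -> T) (x : R) :
  0 <= x ->
  #|[pred v | #|[pred w | c w == c v]|%:R < x]|%:R <= #|T|%:R * x.
Proof.
move=> x0.
have -> : #|T|%:R * x = \sum_(t : T) x by rewrite sumr_const mulr_natl.
rewrite -sum1_card natr_sum (partition_big c predT) //=.
apply: ler_sum => t _.
have [lt|ge] := ltP (#|[pred w | c w == t]|%:R : R) x.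
  apply: le_trans (ltW lt).
  rewrite -sum1_card natr_sum [leLHS]big_mkcond [leRHS]big_mkcond.
  apply: ler_sum => v _; rewrite !inE.
  by case: (c v == t); rewrite ?andbT ?andbF //; case: ifP; rewrite ?ler01.
rewrite big1 // => v; rewrite inE => /andP[h /eqP e].
by rewrite e ltNge ge in h.
Qed.

(** [B] collects the adjacent pairs in irregular cells, in sparse cells, or with an end in a small
    part. A triangle avoiding [B] lies in regular, dense cells between large parts, and counting
    then yields too many triangles. *)
Lemma triangle_removal (R : realType) (eps : R) : 0 < eps ->
  exists2 d : R, 0 < d & forall (V : finType) (a : rel V),
    #|triangles a|%:R < d * #|V|%:R ^+ 3 ->
    exists2 B : {set V * V}, #|B|%:R <= eps * #|V|%:R ^+ 2 &
      forall x y z, a x y -> a y z -> a x z ->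
        [|| (x, y) \in B, (y, z) \in B | (x, z) \in B].
Proof.
move=> eps0.
(* Four kinds of deleted pairs share the budget [eps]; the cap 1 ensures [eta <= 1]. *)
pose eta := Num.min eps 1 / 4.
have eta0 : 0 < eta by rewrite divr_gt0 // lt_min eps0 ltr01.
have eta4 : 4 * eta <= eps.
  have : Num.min eps 1 <= eps by rewrite ge_min lexx.
  by rewrite /eta; lra.
have eta1 : eta <= 1.
  have : Num.min eps 1 <= 1 by rewrite ge_min lexx orbT.
  by rewrite /eta; lra.
(* The counting loss [2 * e] is then half of [eta ^+ 3], the lower bound on the density product. *)
pose e := eta ^+ 3 / 4.
have e0 : 0 < e by rewrite divr_gt0 // exprn_gt0.
have ee : e <= eta.
  rewrite /e ler_pdivrMr //.
  have : eta ^+ 2 <= 1 by apply: exprn_ile1; rewrite ?(ltW eta0).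
  by rewrite exprS; nra.
have [K reg] := cut_regularity e0.
(* At most [K] parts of size below [b * n] hold at most [eta * n] vertices together. *)
pose b := eta / K.+1%:R.
have b0 : 0 < b by rewrite divr_gt0 // ltr0n.
exists (eta ^+ 3 / 2 * b ^+ 3); first by rewrite mulr_gt0 ?divr_gt0 ?exprn_gt0.
move=> V a few.
have [T [c [leT rc]]] := reg V a.
set n : R := #|V|%:R in few *.
have n0 : 0 <= n by rewrite ler0n.
pose N i : R := #|[pred x | c x == i]|%:R.
pose dn := dens (@adj R V a) (col2 c).
pose low p := a p.1 p.2 && (dn (col2 c p) < eta).
pose irr p := cut_irregular a e c (col2 c p).
pose small v := N (c v) < b * n.
exists [set p : V * V | [|| irr p, low p, small p.1 | small p.2] && a p.1 p.2].
  have hV2 : #|{: V * V}|%:R = n ^+ 2 by rewrite card_prod natrM expr2.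
  have cs : #|[pred v | small v]|%:R <= eta * n.
    apply: le_trans (sum_small_fibers c _) _; first by rewrite mulr_ge0 // ltW.
    rewrite mulrA ler_wpM2r // /b mulrCA ger_pMr //.
    by rewrite ler_pdivrMr ?ltr0n // mul1r ler_nat (leq_trans leT).
  have cl : #|[pred p | low p]|%:R <= eta * n ^+ 2.
    rewrite -hV2.
    have -> : #|[pred p | low p]|%:R = \sum_p (dn (col2 c p) < eta)%R%:R * (@adj R V a p).
      rewrite -sum1_card natr_sum big_mkcond; apply: eq_bigr => p _.
      by rewrite inE /low /adj; case: (a _ _); case: (_ < _); rewrite /= ?mulr0 ?mulr1.
    (* Being sparse depends on the cell only, so [adj] can be replaced by the density, which is
       below [eta] on those cells. *)
    rewrite -(@sum_dens R _ _ _ (col2 c) (fun p => (dn (col2 c p) < eta)%R%:R)).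
      rewrite mulr_natr -sumr_const; apply: ler_sum => p _.
      rewrite -/dn; have [lt|_] := ltP; first by rewrite mul1r ltW.
      by rewrite mul0r ltW.
    by move=> p q ->.
  have cs1 : #|[pred p : V * V | small p.1]|%:R <= eta * n ^+ 2.
    rewrite (@eq_card _ _ [predX [pred v | small v] & predT]); last first.
      by move=> p; rewrite !inE andbT.
    by rewrite cardX natrM expr2 mulrA ler_wpM2r.
  have cs2 : #|[pred p : V * V | small p.2]|%:R <= eta * n ^+ 2.
    rewrite (@eq_card _ _ [predX predT & [pred v | small v]]); last first.
      by move=> p; rewrite !inE.
    by rewrite cardX natrM expr2 mulrC mulrA ler_wpM2r.
  have ci : #|[pred p | irr p]|%:R <= eta * n ^+ 2.
    apply: (le_trans rc); rewrite hV2 ler_wpM2r // exprn_ge0 //.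
  apply: (@le_trans _ _ (#|[pred p | irr p]|%:R + #|[pred p | low p]|%:R +
     #|[pred p : V * V | small p.1]|%:R + #|[pred p : V * V | small p.2]|%:R)); last first.
    have : 4 * eta * n ^+ 2 <= eps * n ^+ 2 by rewrite ler_wpM2r // exprn_ge0.
    lra.
  rewrite -!natrD ler_nat.
  rewrite -!sum1_card ![(\sum_(i in _) _)%N]big_mkcond /= -!big_split /=.
  apply: leq_sum => p _; rewrite !inE.
  by case: (irr p); case: (low p); case: (small p.1); case: (small p.2); case: (a _ _).
move=> x y z axy ayz axz.
apply: contraTT few; rewrite !negb_or !inE /= axy ayz axz !andbT /low /= axy ayz axz !andTb.
rewrite !negb_or -!leNgt => /andP[/and4P[rxy lxy sx sy] /andP[/and4P[ryz lyz _ sz] /and4P[_ lxz _ _]]].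
apply: le_trans (triangle_counting e0 rxy ryz).
have bn0 : 0 <= b * n by rewrite mulr_ge0 // ltW.
rewrite -[leLHS]mulrA -exprMn; apply: ler_pM.
- by rewrite divr_ge0 // exprn_ge0 // ltW.
- exact: exprn_ge0.
- have : eta ^+ 3 <= dn (c x, c y) * dn (c y, c z) * dn (c x, c z).
    rewrite exprSr expr2; apply: ler_pM => //; try exact: ltW.
      by rewrite mulr_ge0 // ltW.
    by apply: ler_pM => //; exact: ltW.
  rewrite /e -/dn; lra.
- rewrite exprSr expr2; apply: ler_pM => //; first by rewrite mulr_ge0.
  exact: ler_pM.
Qed.

(** * Cliques and copies of complete graphs *)

Definition pairs (V : finType) (K : {set V}) : {set {set V}} :=
  [set e : {set V} | (e \subset K) && (#|e| == 2)].

Lemma pairs_imset (W V : finType) (f : W -> V) : injective f ->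
  pairs [set f x | x : W] = [set f @: e | e : {set W} in edges (complete W)].
Proof.
move=> injf; apply/setP => e; rewrite inE; apply/andP/imsetP.
  case=> /subsetP eK e2; exists (f @^-1: e).
    rewrite inE; move: e2.
    suff {1}<- : f @: (f @^-1: e) = e by rewrite card_imset.
    apply/setP => v; apply/imsetP/idP; first by case=> x; rewrite inE => h ->.
    by move=> ve; have /imsetP[x _ vx] := eK v ve; exists x; rewrite // inE -vx.
  apply/setP => v; apply/idP/imsetP; last by case=> x; rewrite inE => h ->.
  by move=> ve; have /imsetP[x _ vx] := eK v ve; exists x; rewrite // inE -vx.
case=> e0; rewrite inE => e0_2 ->; rewrite card_imset //; split=> //.
by apply/subsetP => _ /imsetP[x _ ->]; apply: imset_f.
Qed.

Section Cliques.

Variable V : finType.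
Implicit Types (G : sgraph V) (D : {set {set V}}) (K : {set V}).

Definition cliques G r : {set {set V}} :=
  [set K : {set V} | (#|K| == r) && (pairs K \subset edges G)].

Lemma card_edge G e : e \in edges G -> #|e| = 2.
Proof. by move=> eG; apply/eqP; have /forall_inP := edgesP G; apply. Qed.

(** The edge set of a copy of a complete graph is forced by its vertex set, so unlabelled copies
    amount to cliques. *)
Lemma mem_copies_complete G r p :
  (p \in copies 'K_r G) = (p.1 \in cliques G r) && (p.2 == pairs p.1).
Proof.
rewrite !inE; apply/idP/idP.
  case/andP=> /andP[sG _] /existsP[f /and3P[/injectiveP injf /eqP p1 /eqP p2]].
  by rewrite p1 pairs_imset // -p2 sG eqxx card_imset // card_ord eqxx.
case/andP=> /andP[/eqP cK sG] /eqP e2; rewrite /is_subgraph e2 sG /=.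
apply/andP; split; first by apply/forall_inP => e; rewrite inE => /andP[].
pose f := [ffun i => enum_val (cast_ord (esym cK) i)].
have injf : injective f by move=> i j; rewrite !ffunE => /enum_val_inj/cast_ord_inj.
have fK : p.1 = [set f x | x : 'I_r].
  apply/eqP; rewrite eq_sym eqEcard card_imset // card_ord cK leqnn andbT.
  by apply/subsetP => _ /imsetP[x _ ->]; rewrite ffunE; apply: enum_valP.
apply/existsP; exists f; apply/and3P; split; [exact/injectiveP | exact/eqP |].
by rewrite e2 fK pairs_imset.
Qed.

Lemma card_copies_complete G r : #|copies 'K_r G| = #|cliques G r|.
Proof.
have inj : injective (fun K => (K, pairs K)) by move=> K K' [].
rewrite -(card_imset _ inj); apply: eq_card => -[K e].
rewrite mem_copies_complete /=; apply/andP/imsetP => [[h /eqP ->]|[K' h [-> ->]]].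
  by exists K.
by rewrite h eqxx.
Qed.

(** Turns freeness after deletion into a hitting condition, the form that later deletion bounds
    use. *)
Lemma H_free_del_edges G D r : D \subset edges G ->
  H_free 'K_r (del_edges G D) =
  [forall K in cliques G r, [exists e in D, e \subset K]].
Proof.
move=> /subsetP DG.
rewrite /H_free -cards_eq0 card_copies_complete cards_eq0.
apply/eqP/forall_inP => [h K Kc|h].
  apply: contraT => /exists_inPn hD.
  have : K \in cliques (del_edges G D) r.
    move: Kc; rewrite !inE => /andP[-> /subsetP sG] /=; apply/subsetP => e eK.
    rewrite inE sG // andbT; apply/negP => /hD.
    by move: eK; rewrite inE => /andP[->].
  by rewrite h inE.
apply/setP => K; rewrite [RHS]inE; apply/negP; rewrite inE => /andP[cK sD].
have Kc : K \in cliques G r.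
  rewrite inE cK; apply: subset_trans sD _; exact: subsetDl.
have /exists_inP[e eD eK] := h K Kc.
have : e \in pairs K by rewrite inE eK (card_edge (DG e eD)) eqxx.
by move/(subsetP sD); rewrite inE eD.
Qed.

Definition edge_rel G : rel V := fun x y => [set x; y] \in edges G.

Lemma edge_rel_neq G x y : edge_rel G x y -> x != y.
Proof. by move/card_edge; rewrite cards2; case: eqP. Qed.

Lemma edge_rel_sym G : symmetric (edge_rel G).
Proof. by move=> x y; rewrite /edge_rel setUC. Qed.

Lemma clique3 G K : K \in cliques G 3 -> exists x y z,
  [/\ K = [set x; y; z], edge_rel G x y, edge_rel G y z & edge_rel G x z].
Proof.
rewrite inE => /andP[/eqP c3 /subsetP sG].
have /card_gt0P[x xK] : (0 < #|K|)%N by rewrite c3.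
have : #|K :\ x| == 2 by move: c3; rewrite (cardsD1 x) xK => -[/eqP].
case/cards2P => y [z [yz e]].
have eK : K = [set x; y; z] by rewrite -(setD1K xK) e setUA.
have : x \notin K :\ x by rewrite setD11.
rewrite e !inE negb_or => /andP[xy xz].
have P u v : u \in K -> v \in K -> u != v -> edge_rel G u v.
  move=> uK vK uv; apply: sG; rewrite inE cards2 uv eqxx andbT.
  by apply/subsetP => w; rewrite !inE => /orP[] /eqP ->.
by exists x, y, z; split=> //; apply: P => //; rewrite eK !inE eqxx ?orbT.
Qed.

Lemma triple_clique G x y z :
  edge_rel G x y -> edge_rel G y z -> edge_rel G x z -> [set x; y; z] \in cliques G 3.
Proof.
move=> exy eyz exz; have xy := edge_rel_neq exy.
have yz := edge_rel_neq eyz; have xz := edge_rel_neq exz.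
rewrite inE; apply/andP; split.
  by rewrite setUC cardsU1 cards2 !inE negb_or ![z == _]eq_sym xz yz xy.
apply/subsetP => e; rewrite inE => /andP[/subsetP sub /cards2P[u [v [uv e_]]]].
have {sub} := (sub u, sub v); rewrite e_ !inE !eqxx !orbT /=.
have S := edge_rel_sym G.
case=> /(_ isT) /orP[/orP[]|] /eqP eu /(_ isT) /orP[/orP[]|] /eqP ev;
  move: uv; rewrite eu ev ?eqxx // => _; rewrite -/(edge_rel G _ _) //;
  by rewrite S.
Qed.

Lemma card_triangles_le G : (#|triangles (edge_rel G)| <= 9 * #|cliques G 3|)%N.
Proof.
pose P := [set q : {set V} * (V * V) | [&& q.1 \in cliques G 3, q.2.1 \in q.1 & q.2.2 \in q.1]].
have -> : (9 * #|cliques G 3| = #|P|)%N.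
  rewrite mulnC -sum_nat_const -sum1_card (eq_bigl (fun q : {set V} * (V * V) =>
    (q.1 \in cliques G 3) && (q.2 \in setX q.1 q.1))); last first.
    by case=> K [x y]; rewrite inE in_setX.
  rewrite -(pair_big_dep (mem (cliques G 3)) (fun K xy => xy \in setX K K) (fun _ _ => 1%N)) /=.
  apply: eq_bigr => K; rewrite inE => /andP[/eqP c3 _].
  by rewrite sum1_card cardsX c3.
(* A triangle is determined by its vertex set and its first two vertices. *)
pose f (p : V * V * V) := ([set p.1.1; p.1.2; p.2], (p.1.1, p.1.2)).
have T3 x y z : (x, y, z) \in triangles (edge_rel G) -> [/\ x != y, y != z & x != z].
  by rewrite inE => /and3P[/edge_rel_neq ? /edge_rel_neq ? /edge_rel_neq ?].
rewrite -(@card_in_imset _ _ f); last first.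
  move=> [[x y] z] [[x' y'] z'] h h' [/setP e ex ey]; subst x' y'.
  have [_ yz xz] := T3 _ _ _ h; have := e z.
  by rewrite !inE eqxx orbT eq_sym (negPf xz) eq_sym (negPf yz) => /esym/eqP ->.
apply: subset_leq_card; apply/subsetP => _ /imsetP[[[x y] z] h ->].
move: h; rewrite inE /= => /and3P[exy eyz exz].
by rewrite inE /= triple_clique // !inE !eqxx ?orbT.
Qed.

Definition edges_of G (B : {set V * V}) : {set {set V}} :=
  [set e in edges G | [exists p in B, e == [set p.1; p.2]]].

Lemma card_edges_of G B : (#|edges_of G B| <= #|B|)%N.
Proof.
apply: leq_trans (leq_imset_card (fun p : V * V => [set p.1; p.2]) B).
apply: subset_leq_card; apply/subsetP => e; rewrite inE => /andP[_ /exists_inP[p pB /eqP ->]].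
exact: imset_f.
Qed.

Lemma edges_of_sub G B : edges_of G B \subset edges G.
Proof. by apply/subsetP => e; rewrite inE => /andP[]. Qed.

Lemma H_free_edges_of G (B : {set V * V}) :
  (forall x y z, edge_rel G x y -> edge_rel G y z -> edge_rel G x z ->
     [|| (x, y) \in B, (y, z) \in B | (x, z) \in B]) ->
  H_free 'K_3 (del_edges G (edges_of G B)).
Proof.
move=> hB; rewrite H_free_del_edges ?edges_of_sub //.
apply/forall_inP => K /clique3[x [y [z [-> exy eyz exz]]]].
have sub u v : edge_rel G u v -> u \in [set x; y; z] -> v \in [set x; y; z] -> (u, v) \in B ->
    [exists e in edges_of G B, e \subset [set x; y; z]].
  move=> euv uK vK uvB; apply/exists_inP; exists [set u; v].
    by rewrite inE -/(edge_rel G u v) euv; apply/exists_inP; exists (u, v).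
  by apply/subsetP => w; rewrite !inE => /orP[] /eqP ->; rewrite -?in_set1 -?in_setU.
by case/or3P: (hB _ _ _ exy eyz exz) => h; [apply: (sub x y)|apply: (sub y z)|apply: (sub x z)];
  rewrite // !inE eqxx ?orbT.
Qed.

End Cliques.

(** * Graphs with few triangles that are far from triangle-free *)

Lemma delta_K3_gt0 (R : realType) (eps : R) : 0 < eps -> 0 < delta eps 'K_3 0.
Proof.
move=> eps0; have [d d0 rem] := triangle_removal eps0.
have [_ _ maxd] := delta_max eps 'K_3 0.
(* Division by 9 passes from copies to ordered triangles; the cap 1 is the range of [delta]. *)
apply: (@lt_le_trans _ _ (Num.min 1 (d / 9))).
  by rewrite lt_min ltr01 divr_gt0.
apply: maxd => [|n G few _].
  by rewrite ge_min lexx /= le_min ler01 ltW // divr_gt0.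
have := rem _ (edge_rel G); rewrite card_ord => -[|B cB hB].
  rewrite card_copies_complete card_ord in few.
  apply: (@le_lt_trans _ _ (9 * #|cliques G 3|%:R)).
    by rewrite -natrM ler_nat card_triangles_le.
  rewrite mulrC -ltr_pdivlMr // (lt_le_trans few) // mulrAC ler_wpM2r ?exprn_ge0 //.
  by rewrite ge_min lexx orbT.
exists (edges_of G B); split; [exact: edges_of_sub | | exact: H_free_edges_of].
by apply: le_trans cB; rewrite ler_nat card_edges_of.
Qed.

(* The factor 27: for r = 3 the theorem allows delta (alpha n)^3 triangles, whereas
   each A_i has only alpha n / 3 vertices. *)
Lemma far_from_triangle_free (R : realType) (eps : R) : 0 < eps < 1 ->
  exists (U : finType) (a : rel U) (N : nat),
  [/\ (0 < #|U|)%N,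
      #|triangles a|%:R <= 27 * delta eps 'K_3 0 * #|U|%:R ^+ 3,
      eps * #|U|%:R ^+ 2 < N%:R
    & forall D1 D2 D3 : {set U * U},
       (forall x y z, a x y -> a y z -> a x z ->
          [|| (x, y) \in D1, (y, z) \in D2 | (x, z) \in D3]) ->
       (N <= #|D1| + #|D2| + #|D3|)%N].
Proof.
case/andP=> eps0 eps1.
have d0 := delta_K3_gt0 eps0.
have [/andP[_ d1] _ maxd] := delta_max eps 'K_3 0.
move: d0 d1 maxd; set d := delta eps 'K_3 0 => d0 d1 maxd.
(* If delta = 1 no graph is a counterexample to admissibility, and a looped vertex,
   whose tripartite blow-up is complete, takes its place. *)
have [ed|nd] := eqVneq d 1.
  exists unit, (fun _ _ => true), 1%N; rewrite card_unit !expr1n !mulr1 ed mulr1; split=> //.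
    rewrite ler_nat (leq_trans (max_card _)) // !card_prod !card_unit //.
  move=> D1 D2 D3 /(_ tt tt tt isT isT isT).
  by rewrite !addn_gt0 => /or3P[] h; apply/orP; [left; apply/orP; left|left; apply/orP; right|right];
    apply/card_gt0P; exists (tt, tt).
have dlt : d < 1 by rewrite lt_neqAle nd d1.
(* As [0 < d < 1], this value exceeds the maximum [d], so some graph violates admissibility. *)
have : ~ delta_admissible eps 'K_3 0 (Num.min 1 (2 * d)).
  move/maxd; rewrite ge_min lexx le_min ler01 /= mulr_ge0 ?(ltW d0) // => /(_ isT).
  by rewrite ge_min leNgt dlt /= leNgt; lra.
move/existsNP => [n /existsNP[G /not_implyP[few /not_implyP[_ far]]]].
rewrite card_copies_complete card_ord in few.
(* The least integer above [eps * n%:R ^+ 2]; its strict excess later absorbs the rounding of the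
   blow-up factor. *)
exists 'I_n, (edge_rel G), (Num.truncn (eps * n%:R ^+ 2)).+1; rewrite card_ord.
have n0 : (0 < n)%N.
  by rewrite lt0n; apply/eqP => n0; move: few; rewrite (_ : n%:R ^+ 3 = 0) ?n0 ?expr0n // mulr0 ltNge ler0n.
split=> //; last 2 first.
- exact: truncnS_gt.
- move=> D1 D2 D3 hD; rewrite ltnNge; apply/negP => le; apply: far.
  exists (edges_of G (D1 :|: D2 :|: D3)); split; first exact: edges_of_sub.
    apply: (@le_trans _ _ (#|D1| + #|D2| + #|D3|)%:R).
      rewrite ler_nat (leq_trans (card_edges_of _ _)) // cardsU.
      by rewrite (leq_trans (leq_subr _ _)) // leq_add2r cardsU leq_subr.
    by rewrite -truncn_ge_nat // mulr_ge0 ?exprn_ge0 // ltW.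
  apply: H_free_edges_of => x y z xy yz xz; rewrite !inE.
  by case/or3P: (hD _ _ _ xy yz xz) => ->; rewrite ?orbT.
(* At most 9 ordered triangles per copy, and density [2 * d] of copies, give the factor 18, below
   27. *)
apply: (@le_trans _ _ (9 * #|cliques G 3|%:R)).
  by rewrite -natrM ler_nat card_triangles_le.
have : Num.min 1 (2 * d) * n%:R ^+ 3 <= 2 * d * n%:R ^+ 3.
  by rewrite ler_wpM2r ?exprn_ge0 // ge_min lexx orbT.
have : 0 <= d * n%:R ^+ 3 by rewrite mulr_ge0 ?exprn_ge0 // ltW.
lra.
Qed.

(** * Robust families of cliques *)

Local Open Scope nat_scope.

Lemma leq_card_bigcup (I T : finType) (P : pred I) (F : I -> {set T}) :
  #|\bigcup_(i | P i) F i| <= \sum_(i | P i) #|F i|.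
Proof.
elim/big_rec2: _ => [|i n A _ le]; first by rewrite cards0.
by rewrite (leq_trans (leq_card_setU _ _)) // leq_add2l.
Qed.

Section Robust.

Variables (V : finType) (G : sgraph V) (m N : nat).
Implicit Types (K S W B : {set V}) (C D F : {set {set V}}).

Definition hits D K : bool := [exists e in D, e \subset K].

(* Deleting all K in F costs at least N; all K in F through a given vertex can be
   destroyed by m pairs; and some m vertices meet every K in F.  The last two
   conditions make the first one survive joins with independent sets of size >= m. *)
Definition robust F : Prop :=
  [/\ forall D, D \subset pairs [set: V] -> (forall K, K \in F -> hits D K) -> N <= #|D|,
      forall v, exists C, [/\ C \subset pairs [set: V], #|C| <= m &
         forall K, K \in F -> v \in K -> hits C K]
    & exists2 S : {set V}, #|S| <= m & forall K, K \in F -> exists2 v, v \in S & v \in K].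

Definition robust_cliques j B : Prop :=
  exists2 F : {set {set V}}, robust F & forall K, K \in F -> K \in cliques G j /\ K \subset B.

Lemma hitsW D D' K : D \subset D' -> hits D K -> hits D' K.
Proof.
move=> /subsetP s /exists_inP[e eD eK]; apply/exists_inP; exists e => //; exact: s.
Qed.

Lemma robust_cliques_far j B D : robust_cliques j B -> D \subset edges G ->
  H_free 'K_j (del_edges G D) -> N <= #|D|.
Proof.
case=> F [far _ _] FB DG; rewrite H_free_del_edges // => /forall_inP h.
apply: far => [|K /FB[/h hK _]]; last exact: hK.
by apply/subsetP => e /(subsetP DG) eG; rewrite inE subsetT (card_edge eG).
Qed.

(** Pairs avoiding [W] and pairs with exactly one end in [W] form disjoint families in [D], and a
    pair of the second kind determines its end in [W]. *)
Lemma sum_star_le D W (D0 := [set e in D | [disjoint e & W]]) :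
  #|D0| + \sum_(w in W) #|[set v | (v \notin W) && ([set v; w] \in D)]| <= #|D|.
Proof.
pose P := [set q : V * V | [&& q.1 \in W, q.2 \notin W & [set q.2; q.1] \in D]].
have -> : \sum_(w in W) #|[set v | (v \notin W) && ([set v; w] \in D)]| = #|P|.
  rewrite -[RHS]sum1_card (eq_bigl (fun q : V * V => (q.1 \in W) &&
     (q.2 \in [set v | (v \notin W) && ([set v; q.1] \in D)]))); last first.
    by case=> w v; rewrite !inE.
  rewrite -(pair_big_dep (mem W) (fun w v => v \in [set v | (v \notin W) && ([set v; w] \in D)])
     (fun _ _ => 1)) /=.
  by apply: eq_bigr => w _; rewrite sum1_card.
pose f (q : V * V) := [set q.2; q.1].
rewrite -(@card_in_imset _ _ f P); last first.
  move=> [w v] [w' v']; rewrite !inE /= => /and3P[wW vW _] /and3P[w'W v'W _] /setP e.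
  have := e w; have := e v; rewrite !inE !eqxx orbT /=.
  have -> : (w == v') = false by apply/negP => /eqP h; rewrite -h wW in v'W.
  have -> : (v == w') = false by apply/negP => /eqP h; rewrite h w'W in vW.
  by rewrite orbF => /esym/eqP -> /esym/eqP ->.
rewrite -cardsUI (_ : D0 :&: f @: P = set0) ?cards0 ?addn0.
  apply: subset_leq_card; apply/subsetP => e; rewrite inE => /orP[].
    by rewrite inE => /andP[].
  by case/imsetP => -[w v]; rewrite inE => /and3P[_ _ h] ->.
apply/setP => e; rewrite [RHS]inE; apply/negP => /setIP[].
rewrite inE => /andP[_ dis] /imsetP[[w v]]; rewrite inE => /and3P[/= wW _ _] ee.
by move: dis; rewrite ee => /pred0P/(_ w); rewrite /= !inE eqxx orbT wW.
Qed.

(** The new family adds one vertex of [W] to each clique. Cliques through [v] in [W] are destroyed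
    by the at most [m] pairs from [v] to [S]; for other vertices the old pairs still work, and [S]
    still meets every clique. *)
Lemma robust_join j B W : 0 < m <= #|W| ->
  (forall w v, w \in W -> v \in B -> edge_rel G w v) ->
  robust_cliques j B -> robust_cliques j.+1 (B :|: W).
Proof.
case/andP=> m0 mW adjWB [F [far loc [S cS hS]] FB].
have nWB w : w \in W -> w \notin B.
  by move=> wW; apply/negP => /(adjWB w _ wW)/edge_rel_neq; rewrite eqxx.
have KB K v : K \in F -> v \in K -> v \in B by case/FB => _ /subsetP; apply.
exists [set w |: K | K in F, w in W]; first split.
- move=> D D2 hD.
  (* For each w, trading every deleted pair {v, w} for the m pairs through v turns D
     into a set hitting F; sum the resulting bounds over w. *)
  have [C hC] := choice loc.
  pose star w := [set v | (v \notin W) && ([set v; w] \in D)].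
  pose D0 := [set e in D | [disjoint e & W]].
  have one w : w \in W -> N <= #|D0| + m * #|star w|.
    move=> wW; apply: (@leq_trans #|D0 :|: \bigcup_(v in star w) C v|).
      apply: far.
        rewrite subUset; apply/andP; split.
          by apply/subsetP => e; rewrite inE => /andP[/(subsetP D2)].
        by apply/bigcupsP => v _; case: (hC v).
      move=> K KF.
      have /exists_inP[e eD eK] := hD _ (imset2_f (fun K w => w |: K) KF wW).
      have := subsetP D2 _ eD; rewrite inE => /andP[_ /cards2P[x [y [xy ee]]]].
      have key u : [set u; w] = e -> u != w -> hits (D0 :|: \bigcup_(v in star w) C v) K.
        move=> euw uw.
        have uK : u \in K.
          by have := subsetP eK u; rewrite -euw !inE eqxx (negPf uw) /=; apply.
        have uW : u \notin W by apply: contraL (KB _ _ KF uK); exact: nWB.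
        have us : u \in star w by rewrite inE uW euw.
        have [_ _ /(_ K KF uK)] := hC u; apply: hitsW.
        by rewrite subsetU // (bigcup_max u) ?orbT.
      (* A hitting pair through [w] is traded for [C] at its other end; one avoiding [w] lies in
         [K], hence misses [W] and belongs to [D0]. *)
      have [we|we] := boolP (w \in e).
        move: we; rewrite ee !inE => /orP[] /eqP we; subst w.
          by apply: (key y); rewrite ?ee 1?setUC // eq_sym.
        by apply: (key x); rewrite ?ee.
      apply: (@hitsW D0); first exact: subsetUl.
      have eK' : e \subset K.
        apply/subsetP => u ue; have := subsetP eK u ue; rewrite !inE.
        by case/orP => // /eqP uw; rewrite -uw ue in we.
      apply/exists_inP; exists e => //; rewrite inE eD /=.
      apply/pred0P => u /=; apply/negP => /andP[ue /nWB /negP]; apply.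
      exact: KB KF (subsetP eK' _ ue).
    apply: leq_trans (leq_card_setU _ _) _; rewrite leq_add2l.
    apply: leq_trans (leq_card_bigcup _ _) _.
    rewrite mulnC -sum_nat_const; apply: leq_sum => v _; by case: (hC v).
  have : \sum_(w in W) N <= \sum_(w in W) (#|D0| + m * #|star w|).
    by apply: leq_sum.
  rewrite big_split /= !sum_nat_const -big_distrr /= => h.
  have W0 : 0 < #|W| by apply: leq_trans mW.
  rewrite -(leq_pmul2l W0); apply: (leq_trans h).
  apply: (@leq_trans (#|W| * #|D0| + #|W| * \sum_(w in W) #|star w|)).
    by rewrite leq_add2l leq_mul2r mW orbT.
  by rewrite -mulnDr leq_mul2l sum_star_le orbT.
- move=> v; have [vW|vW] := boolP (v \in W).
    exists [set [set v; s] | s in S :&: B]; split.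
    + apply/subsetP => _ /imsetP[s /setIP[_ sB] ->]; rewrite inE subsetT cards2.
      by case: (eqVneq v s) => // vs; move: (nWB v vW); rewrite vs sB.
    + apply: leq_trans (leq_imset_card _ _) _; apply: leq_trans cS.
      by rewrite subset_leq_card // subsetIl.
    + move=> _ /imset2P[K w KF wW ->]; rewrite !inE => /orP[/eqP vw|vK]; last first.
        by move: (nWB v vW); rewrite (KB _ _ KF vK).
      have [s sS sK] := hS K KF; apply/exists_inP; exists [set v; s].
        by apply: imset_f; rewrite inE sS (KB _ _ KF sK).
      by apply/subsetP => u; rewrite !inE => /orP[] /eqP ->; rewrite ?sK ?orbT // vw eqxx.
  have [C [C2 cC hC]] := loc v; exists C; split=> // _ /imset2P[K w KF wW ->].
  rewrite !inE => /orP[/eqP vw|vK]; first by rewrite vw wW in vW.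
  have /exists_inP[e eC eK] := hC K KF vK.
  by apply/exists_inP; exists e => //; rewrite subsetU // eK orbT.
- exists S => // _ /imset2P[K w KF wW ->]; have [v vS vK] := hS K KF.
  by exists v => //; rewrite !inE vK orbT.
move=> _ /imset2P[K w KF wW ->]; have [Kc sKB] := FB K KF.
split; last first.
  by apply/subsetP => u; rewrite !inE => /orP[/eqP ->|/(subsetP sKB) ->]; rewrite ?wW ?orbT.
move: Kc; rewrite !inE => /andP[/eqP cK /subsetP sG].
have wK : w \notin K by apply: contra (nWB w wW) => /(subsetP sKB).
rewrite cardsU1 wK cK add1n eqxx /=.
apply/subsetP => e; rewrite inE => /andP[/subsetP eK e2].
have [we|we] := boolP (w \in e).
  have : #|e :\ w| == 1 by move: e2; rewrite (cardsD1 w) we.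
  case/cards1P => u eu; rewrite -(setD1K we) eu; apply: adjWB => //.
  have : u \in e :\ w by rewrite eu inE.
  rewrite !inE => /andP[uw ue]; move: (eK u ue); rewrite !inE (negPf uw) /=.
  exact: KB.
apply: sG; rewrite inE e2 andbT; apply/subsetP => u ue.
by have := eK u ue; rewrite !inE => /orP[/eqP uw|//]; rewrite -uw ue in we.
Qed.

End Robust.

(** * Robustness of the tripartite blow-up *)

Section Layers.

Variables (V U : finType) (G : sgraph V) (a : rel U) (N t : nat).
(** The blow-up factor is a successor so that ['I_t.+1] is a cyclic group, whose addition indexes
    the layers. *)
Let X : finType := (U * 'I_t.+1)%type.
Variable iota : 'I_3 * X -> V.
Hypothesis iota_inj : injective iota.
Hypothesis iota_edge : forall (i j : 'I_3) x y, i < j -> a x.1 y.1 ->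
  edge_rel G (iota (i, x)) (iota (j, y)).
Hypothesis far : forall D1 D2 D3 : {set U * U},
  (forall x y z, a x y -> a y z -> a x z ->
     [|| (x, y) \in D1, (y, z) \in D2 | (x, z) \in D3]) ->
  N <= #|D1| + #|D2| + #|D3|.

Let i0 : 'I_3 := @Ordinal 3 0 isT.
Let i1 : 'I_3 := @Ordinal 3 1 isT.
Let i2 : 'I_3 := @Ordinal 3 2 isT.

Lemma sum_ord3 (F : 'I_3 -> nat) : \sum_i F i = F i0 + F i1 + F i2.
Proof.
rewrite !big_ord_recl big_ord0 addn0 addnA; congr (F _ + F _ + F _); exact: val_inj.
Qed.

Lemma sum_ord3_lt (F : 'I_3 -> 'I_3 -> nat) :
  \sum_(i : 'I_3) \sum_(j : 'I_3 | i < j) F i j = F i0 i1 + F i0 i2 + F i1 i2.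
Proof.
have mk (i : 'I_3) : \sum_(j : 'I_3 | i < j) F i j =
    \sum_(j : 'I_3) if i < j then F i j else 0 by rewrite big_mkcond.
by rewrite sum_ord3 !mk !sum_ord3 /= !add0n !addn0.
Qed.

Lemma iota_pair p q : p != q -> [set iota p; iota q] \in pairs [set: V].
Proof. by move=> pq; rewrite inE subsetT cards2 (inj_eq iota_inj) pq. Qed.

(** Each pair in [D] is counted at most once: [iota] is injective, and the order of the parts tells
    the two ends apart. *)
Lemma sum_parts_le (D : {set {set V}})
  (g := fun i j (x y : X) => nat_of_bool ([set iota (i, x); iota (j, y)] \in D)) :
  \sum_x \sum_y g i0 i1 x y + \sum_x \sum_y g i1 i2 x y + \sum_x \sum_y g i0 i2 x y <= #|D|.
Proof.
pose P := [set q : ('I_3 * X) * ('I_3 * X) | (q.1.1 < q.2.1) && ([set iota q.1; iota q.2] \in D)].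
apply: (@leq_trans #|P|); last first.
  rewrite -(@card_in_imset _ _ (fun q => [set iota q.1; iota q.2]) P); last first.
    move=> [p q] [p' q']; rewrite !inE /= => /andP[pq _] /andP[pq' _] /setP e.
    have hp : (p == p') || (p == q') by have := e (iota p); rewrite !inE eqxx !(inj_eq iota_inj).
    have hq : (q == p') || (q == q').
      by have := e (iota q); rewrite !inE eqxx orbT !(inj_eq iota_inj).
    move: pq pq' hq hp => pq pq' /orP[] /eqP hq /orP[] /eqP hp.
    - by move: pq; rewrite hp hq ltnn.
    - by move: pq; rewrite hp hq ltnNge ltnW.
    - by rewrite hp hq.
    - by move: pq; rewrite hp hq ltnn.
  by apply: subset_leq_card; apply/subsetP => e /imsetP[q]; rewrite inE => /andP[_ h] ->.
have -> : #|P| = \sum_(i : 'I_3) \sum_(j : 'I_3 | i < j) \sum_x \sum_y g i j x y.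
  transitivity (\sum_p \sum_q nat_of_bool ((p, q) \in P)).
    rewrite pair_bigA -sum1_card big_mkcond; apply: eq_bigr => -[p q] _.
    by case: (_ \in _).
  transitivity (\sum_i \sum_x \sum_j \sum_y nat_of_bool (((i, x), (j, y)) \in P)).
    rewrite [RHS]pair_bigA; apply: eq_bigr => -[i x] _.
    by rewrite [RHS]pair_bigA; apply: eq_bigr => -[j y] _.
  apply: eq_bigr => i _; rewrite [RHS]exchange_big /=; apply: eq_bigr => x _.
  rewrite [RHS]big_mkcond /=; apply: eq_bigr => j _.
  case: ifP => ij; last by rewrite big1 // => y _; rewrite inE /= ij.
  by apply: eq_bigr => y _; rewrite inE /= ij.
by rewrite sum_ord3_lt addnAC.
Qed.

Lemma layers_far (D : {set {set V}}) : D \subset pairs [set: V] ->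
  (forall x y z : X, a x.1 y.1 -> a y.1 z.1 -> a x.1 z.1 ->
     hits D [set iota (i0, x); iota (i1, y); iota (i2, z)]) ->
  N * t.+1 ^ 2 <= #|D|.
Proof.
move=> D2 hD; apply: leq_trans (sum_parts_le D).
pose g i j (x y : X) := nat_of_bool ([set iota (i, x); iota (j, y)] \in D).
pose S i j := \sum_(p < t.+1) \sum_(q < t.+1) \sum_u \sum_v g i j (u, p) (v, q).
have SE i j : \sum_x \sum_y g i j x y = S i j.
  transitivity (\sum_u \sum_(p < t.+1) \sum_v \sum_(q < t.+1) g i j (u, p) (v, q)).
    rewrite [RHS]pair_bigA; apply: eq_bigr => -[u p] _.
    by rewrite [RHS]pair_bigA; apply: eq_bigr => -[v q] _.
  rewrite exchange_big /=; apply: eq_bigr => p _.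
  rewrite [RHS]exchange_big /=; apply: eq_bigr => u _.
  by rewrite exchange_big.
rewrite !SE.
(* The layers (p, q, p + q) of the three parts are pairwise edge-disjoint copies of
   the unblown graph: any two of the coordinates p, q, p + q determine the third. *)
have -> : N * t.+1 ^ 2 = \sum_(p < t.+1) \sum_(q < t.+1) N.
  by rewrite !sum_nat_const !card_ord mulnC -mulnA.
have -> : S i1 i2 = \sum_(p < t.+1) \sum_(q < t.+1) \sum_u \sum_v g i1 i2 (u, q) (v, (p + q)%R).
  rewrite [RHS]exchange_big /=; apply: eq_bigr => q _.
  by rewrite [RHS](reindex_inj (GRing.addIr (- q)%R)) /=; apply: eq_bigr => p _; rewrite GRing.subrK.
have -> : S i0 i2 = \sum_(p < t.+1) \sum_(q < t.+1) \sum_u \sum_v g i0 i2 (u, p) (v, (p + q)%R).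
  apply: eq_bigr => p _.
  by rewrite [RHS](reindex_inj (GRing.addrI (- p)%R)) /=; apply: eq_bigr => q _; rewrite GRing.addNKr.
rewrite /S -!big_split; apply: leq_sum => p _; rewrite -!big_split; apply: leq_sum => q _ /=.
have conv (f : U -> U -> bool) : \sum_u \sum_v f u v = #|[set w : U * U | f w.1 w.2]|.
  rewrite pair_bigA -sum1_card [RHS]big_mkcond; apply: eq_bigr => -[u v] _.
  by rewrite inE /=; case: (f u v).
rewrite !conv; apply: far => x y z xy yz xz; rewrite !inE /=.
have /exists_inP[e eD /subsetP eK] := hD (x, p) (y, q) (z, (p + q)%R) xy yz xz.
have := subsetP D2 e eD; rewrite inE => /andP[_ /cards2P[u [v [uv ee]]]].
have {eK} := (eK u, eK v); rewrite ee !inE !eqxx !orbT /= => -[/(_ isT) hu /(_ isT) hv].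
move: hu hv uv ee => /orP[/orP[]|] /eqP -> /orP[/orP[]|] /eqP ->;
  rewrite ?eqxx // => _ ee; move: eD; rewrite ee;
  first [by move=> ->; rewrite ?orbT | by rewrite setUC => ->; rewrite ?orbT].
Qed.

Lemma iota_clique x y z : a x.1 y.1 -> a y.1 z.1 -> a x.1 z.1 ->
  [set iota (i0, x); iota (i1, y); iota (i2, z)] \in cliques G 3.
Proof.
move=> xy yz xz; apply: triple_clique; exact: iota_edge.
Qed.

(** Base case for the joins: the [#|X|] pairs from [v] to one other part destroy all triangles of
    the family through [v], and the first part meets every such triangle. *)
Lemma robust_layers :
  robust_cliques G #|X| (N * t.+1 ^ 2) 3 [set iota p | p : 'I_3 * X].
Proof.
pose tri (p : X * X * X) := [set iota (i0, p.1.1); iota (i1, p.1.2); iota (i2, p.2)].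
pose a' : rel X := fun x y => a x.1 y.1.
exists [set tri p | p in triangles a']; first split.
- move=> D D2 hD; apply: layers_far => // x y z xy yz xz.
  by apply: (hD (tri (x, y, z))); apply: imset_f; rewrite inE /a' /= xy yz.
- move=> v; have [/codomP[[i x] ->]|vi] := boolP (v \in codom iota); last first.
    exists set0; split; rewrite ?sub0set ?cards0 // => _ /imsetP[p _ ->].
    by rewrite !inE => /orP[/orP[]|] /eqP vE; rewrite vE codom_f in vi.
  pose j := if i == i0 then i1 else i0.
  have ij : i != j by rewrite /j; case: (eqVneq i i0) => [->|].
  exists [set [set iota (i, x); iota (j, y)] | y : X]; split.
  + by apply/subsetP => _ /imsetP[y _ ->]; apply: iota_pair; rewrite xpair_eqE (negPf ij).
  + exact: leq_imset_card.
  + move=> _ /imsetP[p _ ->] vK.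
    have [y yK] : exists y, iota (j, y) \in tri p.
      rewrite /j /tri; case: ifP => _; [exists p.1.2 | exists p.1.1];
      by rewrite !inE eqxx ?orbT.
    apply/exists_inP; exists [set iota (i, x); iota (j, y)]; first exact: imset_f.
    by apply/subsetP => u; rewrite inE => /orP[] /set1P ->.
- exists [set iota (i0, x) | x : X]; first exact: leq_imset_card.
  move=> _ /imsetP[p _ ->]; exists (iota (i0, p.1.1)); first exact: imset_f.
  by rewrite !inE eqxx.
move=> K /imsetP[[[x y] z]]; rewrite inE /a' /= => /and3P[xy yz xz] ->; split.
  exact: iota_clique.
by apply/subsetP => u; rewrite !inE => /orP[/orP[]|] /eqP ->; apply: imset_f.
Qed.

End Layers.

(** * The construction *)

Section RelGraph.

Variables (V : finType) (E : rel V).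

Fact rel_graph_subproof :
  [forall e in [set [set p.1; p.2] | p : V * V & (p.1 != p.2) && E p.1 p.2], #|e| == 2].
Proof.
apply/forall_inP => e /imsetP[p]; rewrite inE => /andP[p12 _] ->.
by rewrite cards2 p12.
Qed.

Definition rel_graph : sgraph V := SGraph rel_graph_subproof.

Lemma edge_rel_graph : symmetric E -> irreflexive E -> edge_rel rel_graph =2 E.
Proof.
move=> sE iE x y; apply/imsetP/idP => [[[u v]]|xy]; last first.
  by exists (x, y); rewrite // inE /= xy andbT; apply: contraTneq xy => ->; rewrite iE.
rewrite inE /= => /andP[uv Euv] /setP e.
have ux : (u == x) || (u == y) by have := e u; rewrite !inE eqxx.
have vx : (v == x) || (v == y) by have := e v; rewrite !inE eqxx orbT.
move: uv Euv; case/orP: ux => /eqP ->; case/orP: vx => /eqP -> //; rewrite ?eqxx //.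
by rewrite sE.
Qed.

End RelGraph.

Lemma deg_ge (V I : finType) (G : sgraph V) v (g : I -> V) :
  injective g -> (forall i, edge_rel G v (g i)) -> #|I| <= deg G v.
Proof.
move=> injg adj.
have inj : injective (fun i => [set v; g i]).
  move=> i j /setP e; apply: injg; have := e (g i); rewrite !inE eqxx orbT.
  by move/esym/orP => [/eqP h|/eqP //]; have := edge_rel_neq (adj i); rewrite h eqxx.
rewrite -(card_imset _ inj); apply: subset_leq_card; apply/subsetP => _ /imsetP[i _ ->].
by rewrite inE -/(edge_rel G v (g i)) adj !inE eqxx.
Qed.

Section Construction.

Variables (U : finType) (a : rel U) (q s t w l : nat).
Let X : finType := (U * 'I_t.+1)%type.

(* 'I_l holds the rounding leftovers, which behave like vertices of B_0. *)
Definition vertex : finType :=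
  ('I_3 * X + ('I_3 * 'I_s + 'I_l) + 'I_q * 'I_w)%type.

Definition inA p : vertex := inl (inl p).
Definition inB p : vertex := inl (inr (inl p)).
Definition inW p : vertex := inr p.

Lemma card_vertex : #|vertex| = 3 * (#|U| * t.+1) + (3 * s + l) + q * w.
Proof. by rewrite !card_sum !card_prod !card_ord. Qed.

Inductive label := LA of 'I_3 & U | LB of 'I_3 | LW of 'I_q.

Definition lab (v : vertex) : label :=
  match v with
  | inl (inl p) => LA p.1 p.2.1
  | inl (inr (inl p)) => LB p.1
  | inl (inr (inr _)) => LB ord0
  | inr p => LW p.1
  end.

(** Between two A parts, [a] is read from the smaller index to the larger, so the adjacency is
    symmetric for any [a]. Two B vertices are adjacent when exactly one has index 0. *)
Definition label_adj (x y : label) : bool :=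
  match x, y with
  | LA i u, LA j v => (i < j) && a u v || (j < i) && a v u
  | LA i _, LB j | LB j, LA i _ => i == j
  | LB i, LB j => (i == ord0) != (j == ord0)
  | LW i, LW j => i != j
  | LW _, _ | _, LW _ => true
  end.

Lemma label_adj_sym : symmetric label_adj.
Proof. by case=> [i u|i|i] [j v|j|j] //=; rewrite 1?orbC 1?eq_sym. Qed.

Lemma label_adj_irr : irreflexive label_adj.
Proof. by case=> [i u|i|i] /=; rewrite ?ltnn ?eqxx. Qed.

Variables (V : finType) (phi : V -> vertex) (psi : vertex -> V).
Hypotheses (phiK : cancel phi psi) (psiK : cancel psi phi).

Definition blowup : sgraph V := rel_graph (fun x y => label_adj (lab (phi x)) (lab (phi y))).

Lemma blowupE x y : edge_rel blowup x y = label_adj (lab (phi x)) (lab (phi y)).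
Proof. by apply: edge_rel_graph => [u v|u]; [exact: label_adj_sym | exact: label_adj_irr]. Qed.

Lemma blowup_psi x y : edge_rel blowup (psi x) (psi y) = label_adj (lab x) (lab y).
Proof. by rewrite blowupE !psiK. Qed.

Let psi_inj : injective psi := can_inj psiK.

(** A vertex labelled A or B sees a whole B_j and all the W_j; a vertex of W_j misses only its own
    part, of size [w]. *)
Lemma deg_blowup v : s + q * w <= deg blowup v \/ #|vertex| <= deg blowup v + w.
Proof.
have small (j : 'I_3) : (forall x, lab x = LB j -> label_adj (lab (phi v)) (lab x)) ->
    (forall x : 'I_q * 'I_w, label_adj (lab (phi v)) (LW x.1)) ->
    s + q * w <= deg blowup v.
  move=> hB hW; pose g (x : 'I_s + ('I_q * 'I_w)) : vertex :=
    match x with inl b => inB (j, b) | inr c => inW c end.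
  have injg : injective (psi \o g).
    apply: inj_comp => //; move=> [b|c] [b'|c'] //=; rewrite /inB /inW; first by case=> ->.
    by case=> ->.
  have -> : s + q * w = #|{: 'I_s + ('I_q * 'I_w)}|.
    by rewrite card_sum card_prod !card_ord.
  by apply: deg_ge injg _ => -[b|c]; rewrite /= blowupE psiK; [apply: hB | apply: hW].
case E: (lab (phi v)) => [i u|i|i] in small *.
- by left; apply: (small i) => [x ->|//] /=.
- left; apply: (small (if i == ord0 then ord_max else ord0)) => [x ->|//] /=.
  by case: (i == ord0).
right; pose P (x : vertex) := if x is inr p then p.1 != i else true.
rewrite -(cardC P) leq_add //.
  rewrite -card_sig.
  have injg : injective (psi \o (fun x : {x | P x} => val x)).
    by apply: inj_comp => //; exact: val_inj.
  apply: deg_ge injg _ => -[x Px]; rewrite /= blowupE psiK E.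
  by case: x Px => [[p|[p|p]]|p] //=; rewrite /P eq_sym.
rewrite -[leqRHS]card_ord -(card_codom (_ : injective (fun b : 'I_w => inW (i, b)))); last first.
  by move=> b b' [].
apply: subset_leq_card; apply/subsetP => -[[p|[p|p]]|[j b]] //.
by rewrite unfold_in /= negbK => /eqP /= ->; apply: codom_f.
Qed.

(** There are exactly [q + 3] colours, so a clique of that size meets every class. B_0 shares a
    colour with A_1, and B_1, B_2 share one with A_0; no edges join sets of the same colour. *)
Definition colour (v : vertex) : 'I_3 + 'I_q :=
  match v with
  | inl (inl p) => inl p.1
  | inl (inr (inl p)) => inl (if p.1 == ord0 then inord 1 else ord0)
  | inl (inr (inr _)) => inl (inord 1)
  | inr p => inr p.1
  end.

Lemma colour_proper x y : label_adj (lab x) (lab y) -> colour x != colour y.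
Proof.
have i1 : (inord 1 : 'I_3) == ord0 = false by rewrite -val_eqE /= inordK.
have C (i j : 'I_3) : i == j -> i != (if j == ord0 then inord 1 else ord0).
  by move/eqP->; case: (eqVneq j ord0) => [->|//]; rewrite eq_sym i1.
have D (i j : 'I_3) : (i == ord0) != (j == ord0) ->
    (if i == ord0 then inord 1 else ord0 : 'I_3) != (if j == ord0 then inord 1 else ord0).
  by case: (i == _); case: (j == _); rewrite // ?[ord0 == _]eq_sym i1.
case: x => [[[i x]|[[i b]|c]]|[i b]]; case: y => [[[j y]|[[j b']|c']]|[j b']] //=.
- by case/orP => /andP[ij _]; apply/negP => /eqP[] ij'; rewrite ij' ltnn in ij.
- exact: C.
- exact: (C i ord0).
- by move=> h; rewrite eq_sym; apply: C.
- exact: D.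
- exact: (D i ord0).
- by move=> h; rewrite eq_sym; apply: (C j ord0).
- exact: (D ord0 j).
Qed.

Let i0 : 'I_3 := @Ordinal 3 0 isT.
Let i1 : 'I_3 := @Ordinal 3 1 isT.
Let i2 : 'I_3 := @Ordinal 3 2 isT.

Definition assemble (p : (U * U * U) * ('I_t.+1 * 'I_t.+1 * 'I_t.+1) * {ffun 'I_q -> 'I_w}) : {set V} :=
  let: (u, c, f) := p in
  [set psi (inA (i0, (u.1.1, c.1.1))); psi (inA (i1, (u.1.2, c.1.2))); psi (inA (i2, (u.2, c.2)))]
    :|: [set psi (inW (j, f j)) | j : 'I_q].

(** Only A_2 has the third colour. Its neighbour of the second colour is not in B_0, hence lies in
    A_1. No vertex of B_1 or B_2 is adjacent to both A_1 and A_2, so the remaining vertex lies in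
    A_0. *)
Lemma triangle_labels v0 v1 v2 :
  colour v0 = inl i0 -> colour v1 = inl i1 -> colour v2 = inl i2 ->
  label_adj (lab v0) (lab v1) -> label_adj (lab v1) (lab v2) -> label_adj (lab v0) (lab v2) ->
  exists x0 x1 x2 : X,
    [/\ v0 = inA (i0, x0), v1 = inA (i1, x1) & v2 = inA (i2, x2)] /\
    [/\ a x0.1 x1.1, a x1.1 x2.1 & a x0.1 x2.1].
Proof.
have inlI (x y : 'I_3) : @inl 'I_3 'I_q x = inl y -> x = y by case.
have e1 : inord 1 = i1 by apply: val_inj; rewrite /= inordK.
have e0 : ord0 = i0 by apply: val_inj.
have d (k : 'I_3) : (if k == ord0 then inord 1 else ord0 : 'I_3) = if k == i0 then i1 else i0.
  by rewrite e0 e1.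
case: v2 => [[[k2 x2]|[[k2 b2]|c2]]|[k2 b2]] //=; rewrite ?d ?e1 ?e0 //; last first.
  by case: ifP => _ _ _ /eqP.
case: v1 => [[[k1 x1]|[[k1 b1]|c1]]|[k1 b1]] //=; rewrite ?d ?e1 ?e0 //; last first.
- by move=> _ _ [->].
- by case: ifP => // /eqP -> _ _ [->].
case: v0 => [[[k0 x0]|[[k0 b0]|c0]]|[k0 b0]] //=; rewrite ?d ?e1 ?e0 //; last first.
  by move=> _ /inlI -> /inlI -> /eqP <- _ /eqP.
move=> /inlI -> /inlI -> /inlI -> /=; rewrite !orbF => xy yz xz.
by exists x0, x1, x2.
Qed.

Lemma cliques_assemble :
  cliques blowup q.+3 \subset
    [set assemble p | p in setX (setX (triangles a) setT) setT].
Proof.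
apply/subsetP => K; rewrite inE => /andP[/eqP cK /subsetP sK].
have adjK x y : x \in K -> y \in K -> x != y -> label_adj (lab (phi x)) (lab (phi y)).
  move=> xK yK xy; rewrite -blowupE; apply: sK.
  by rewrite inE cards2 xy eqxx andbT; apply/subsetP => z; rewrite !inE => /orP[] /eqP ->.
pose col v := colour (phi v).
have colI : {in K &, injective col}.
  move=> x y xK yK; apply: contra_eq => xy; exact: colour_proper (adjK _ _ xK yK xy).
have colS c : exists v, v \in K /\ col v = c.
  have : [set col v | v in K] = setT.
    apply/eqP; rewrite eqEcard subsetT card_in_imset // cardsT card_sum !card_ord cK.
    exact: leqnn.
  by move/setP/(_ c); rewrite inE => /imsetP[v vK ->]; exists v.
have [f hf] := fin_all_exists colS.
have fK c : f c \in K by case: (hf c).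
have fcol c : colour (phi (f c)) = c by case: (hf c).
have fneq c c' : c != c' -> f c != f c'.
  by apply: contraNneq => e; rewrite -(fcol c) e fcol.
have fadj c c' : c != c' -> label_adj (lab (phi (f c))) (lab (phi (f c'))).
  by move=> cc; apply: adjK => //; apply: fneq.
have [x0 [x1 [x2 [[e0 e1 e2] [a01 a12 a02]]]]] :=
  triangle_labels (fcol (inl i0)) (fcol (inl i1)) (fcol (inl i2))
    (fadj (inl i0) (inl i1) isT) (fadj (inl i1) (inl i2) isT) (fadj (inl i0) (inl i2) isT).
have colW j : exists b, phi (f (inr j)) = inW (j, b).
  have := fcol (inr j); case: (phi _) => [[[k x]|[[k b]|c]]|[k b]] //= [->].
  by exists b.
have [g hg] := fin_all_exists colW.
apply/imsetP; exists ((x0.1, x1.1, x2.1), (x0.2, x1.2, x2.2), finfun g).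
  by rewrite !in_setX !inE /= a01 a12 a02.
have f0 : psi (inA (i0, (x0.1, x0.2))) = f (inl i0) by rewrite -surjective_pairing -e0 phiK.
have f1 : psi (inA (i1, (x1.1, x1.2))) = f (inl i1) by rewrite -surjective_pairing -e1 phiK.
have f2 : psi (inA (i2, (x2.1, x2.2))) = f (inl i2) by rewrite -surjective_pairing -e2 phiK.
have fW j : psi (inW (j, finfun g j)) = f (inr j) by rewrite ffunE -hg phiK.
rewrite /assemble /= f0 f1 f2.
apply/eqP; rewrite eqEsubset; apply/andP; split; apply/subsetP => v; rewrite !inE; last first.
  by case/orP => [/orP[/orP[]|] /eqP -> //|/imsetP[j _ ->]]; rewrite fW.
move=> vK; have -> : v = f (col v) by apply: colI => //; rewrite /col fcol.
case: (col v) => [[[|[|[|//]]] k]|j].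
- by rewrite (_ : Ordinal k = i0) ?eqxx //; apply: val_inj.
- by rewrite (_ : Ordinal k = i1) ?eqxx ?orbT //; apply: val_inj.
- by rewrite (_ : Ordinal k = i2) ?eqxx ?orbT //; apply: val_inj.
by apply/orP; right; apply/imsetP; exists j.
Qed.

Lemma card_cliques_blowup :
  #|cliques blowup q.+3| <= #|triangles a| * t.+1 ^ 3 * w ^ q.
Proof.
apply: leq_trans (subset_leq_card cliques_assemble) _.
apply: leq_trans (leq_imset_card _ _) _.
rewrite !cardsX !cardsT !card_prod card_ffun !card_ord.
by have -> : t.+1 ^ 3 = t.+1 * t.+1 * t.+1 by rewrite -mulnA.
Qed.

(** Starting from the triangles in the A parts, the sets W_j are joined one at a time; [#|X| <= w]
    is the size condition of [robust_join]. *)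
Lemma robust_blowup (N : nat) :
  0 < #|X| <= w ->
  (forall D1 D2 D3 : {set U * U},
    (forall x y z, a x y -> a y z -> a x z ->
       [|| (x, y) \in D1, (y, z) \in D2 | (x, z) \in D3]) ->
    N <= #|D1| + #|D2| + #|D3|) ->
  forall D : {set {set V}}, D \subset edges blowup -> H_free 'K_(q.+3) (del_edges blowup D) ->
    N * t.+1 ^ 2 <= #|D|.
Proof.
move=> Xw far D; apply: (@robust_cliques_far _ _ #|X| _ _
   [set v | if phi v is inl (inr _) then false else true]).
pose B k := [set v | match phi v with inl (inl _) => true | inr p => p.1 < k | _ => false end].
have -> : [set v | if phi v is inl (inr _) then false else true] = B q.
  by apply/setP => v; rewrite !inE; case: (phi v) => [[]|[j b]] //=; rewrite ltn_ord.
suff : forall k, k <= q -> robust_cliques blowup #|X| (N * t.+1 ^ 2) k.+3 (B k) by apply.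
elim=> [_|k IH kq].
  have -> : B 0 = [set psi (inA p) | p : 'I_3 * X].
    apply/setP => v; rewrite !inE; apply/idP/imsetP => [|[p _ ->]]; last by rewrite psiK.
    by case E: (phi v) => [[p|]|] // _; exists p; rewrite // -[LHS]phiK E.
  apply: robust_layers far => [|i j x y ij xy].
    by apply: inj_comp psi_inj _ => p p' [].
  by rewrite blowup_psi /= ij xy.
pose W := [set psi (inW (Ordinal kq, b)) | b : 'I_w].
have -> : B k.+1 = B k :|: W.
  apply/setP => v; rewrite !inE; apply/idP/orP => [|[|/imsetP[b _ ->]]].
  - case E: (phi v) => [[p|p]|[j b]] //=; first by left.
    rewrite ltnS leq_eqVlt => /orP[/eqP jk|]; last by left.
    right; apply/imsetP; exists b => //.
    by rewrite -[LHS]phiK E; congr (psi (inW (_, _))); apply: val_inj.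
  - by case: (phi v) => [[]|[j b]] //= /ltnW; rewrite ltnS.
  - by rewrite psiK /=.
apply: robust_join; last by apply: IH; rewrite ltnW.
  by rewrite card_imset ?card_ord // => b b' /psi_inj[].
move=> _ v /imsetP[b _ ->]; rewrite inE blowupE psiK.
case: (phi v) => [[]|[j c]] //= jk.
by apply/negP => /eqP e; rewrite -e /= ltnn in jk.
Qed.

End Construction.

Lemma exists_blowup (U : finType) (a : rel U) (q s t w l N n : nat) :
  0 < #|U| -> 0 < t -> #|U| * t <= w ->
  n = 3 * (#|U| * t) + (3 * s + l) + q * w ->
  (forall D1 D2 D3 : {set U * U},
    (forall x y z, a x y -> a y z -> a x z ->
       [|| (x, y) \in D1, (y, z) \in D2 | (x, z) \in D3]) ->
    N <= #|D1| + #|D2| + #|D3|) ->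
  exists G : sgraph 'I_n,
  [/\ forall v, s + q * w <= deg G v \/ n <= deg G v + w,
      #|copies 'K_(q.+3) G| <= #|triangles a| * t ^ 3 * w ^ q
    & forall D : {set {set 'I_n}}, D \subset edges G ->
        H_free 'K_(q.+3) (del_edges G D) -> N * t ^ 2 <= #|D|].
Proof.
case: t => // t U0 _ Utw nE far; move: nE; rewrite -(card_vertex U q s t w l) => ->.
exists (blowup a (enum_val : 'I_#|vertex U q s t w l| -> vertex U q s t w l)); split.
- by move=> v; apply: (deg_blowup a (@enum_rankK _)).
- by rewrite card_copies_complete (card_cliques_blowup a (@enum_valK _)).
apply: (robust_blowup (@enum_valK _) (@enum_rankK _) _ far).
by rewrite card_prod card_ord muln_gt0 U0.
Qed.

(** * Choice of parameters and the final bound *)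

Local Open Scope ring_scope.

(** Combines [r <= 2 * r - 3], valid as [r] is at least 3, with [27 * 2 ^+ q <= 3 ^+ r]. *)
Lemma clique_bound_constant (R : realFieldType) (q : nat) (r := q.+3) :
  27 * 2 ^+ q / (2 * r%:R - 3) ^+ r <= ((r%:R / 3) ^+ r)^-1 :> R.
Proof.
have r0 : (0 : R) < r%:R by rewrite ltr0n.
have r3 : (3 : R) <= r%:R by rewrite ler_nat.
set k := 2 * r%:R - 3; have rk : r%:R <= k by rewrite /k; lra.
have k0 : 0 < k by apply: lt_le_trans rk.
rewrite ler_pdivrMr ?exprn_gt0 // [leRHS]mulrC ler_pdivlMr ?exprn_gt0 ?divr_gt0 //.
apply: (@le_trans _ _ (r%:R ^+ r)); last by apply: lerXn2r; rewrite ?nnegrE ?(ltW r0) ?(ltW k0).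
rewrite expr_div_n mulrCA ger_pMr ?exprn_gt0 //.
rewrite ler_pdivrMr ?exprn_gt0 // mul1r /r (exprD 3 3 q) (_ : 3 ^+ 3 = 27); last by ring.
by rewrite ler_pM2l // lerXn2r ?nnegrE // ler_nat.
Qed.

(** With [z = n / k], the sizes are about [alpha * z] for A_i, [(1 - alpha) * z] for B_i and [2 * z]
    for W_j, rounded down; large [n] absorbs the rounding. The strict deletion bound serves the
    inequality for [delta]. *)
Lemma far_graphs (R : realType) (q : nat) (alpha eps : R) (r := q.+3)
    (k := 2 * r%:R - 3 : R) :
  0 < alpha <= 1 -> 0 < eps -> k ^+ 2 / alpha ^+ 2 * eps < 1 ->
  exists n0 : nat, forall n : nat, (n0 <= n)%N -> (0 < n)%N /\
     exists G : sgraph 'I_n,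
       [/\ min_deg_ge G (((k - 2) / k - alpha) * n%:R),
           #|copies 'K_r G|%:R <= alpha ^+ 3 / (r%:R / 3) ^+ r
              * delta (k ^+ 2 / alpha ^+ 2 * eps) 'K_3 0 * n%:R ^+ r
         & forall D : {set {set 'I_n}}, D \subset edges G ->
             H_free 'K_r (del_edges G D) -> eps * n%:R ^+ 2 < #|D|%:R].
Proof.
case/andP=> al0 al1 eps0 E1.
have q0 : (0 : R) <= q%:R by rewrite ler0n.
have kq : k = 2 * q%:R + 3 by rewrite /k /r -!natr1; ring.
have k3 : 3 <= k by rewrite kq; lra.
have k0 : 0 < k by lra.
have E0 : 0 < k ^+ 2 / alpha ^+ 2 * eps by rewrite mulr_gt0 // divr_gt0 // exprn_gt0.
have [U [a [N [U0 fewT EN far]]]] := far_from_triangle_free (introT andP (conj E0 E1)).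
set E := k ^+ 2 / alpha ^+ 2 * eps in E0 E1 fewT EN *.
set d := delta E _ _ in fewT *.
set M : R := #|U|%:R in fewT EN.
have M0 : 0 < M by rewrite ltr0n.
(* [c] is the surplus in the deletion bound; [b] makes the unrounded blow-up factor [b * n] give A
   parts of size [alpha * n / k]. *)
pose c := N%:R - E * M ^+ 2; have c0 : 0 < c by rewrite subr_gt0.
pose b := alpha / (k * M); have b0 : 0 < b by rewrite divr_gt0 // mulr_gt0.
(* The first term makes the surplus beat the rounding of [t], the second makes [alpha * n] beat the
   rounding in the degrees. *)
pose bnd := (1 + 2 * N%:R / c) / b + 2 * (1 + q%:R) / alpha.
have Nc0 : 0 <= 2 * N%:R / c by rewrite divr_ge0 ?(ltW c0) // mulr_ge0.
have t1_0 : 0 <= (1 + 2 * N%:R / c) / b.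
  by rewrite divr_ge0 ?(ltW b0) // addr_ge0.
have t2_0 : 0 <= 2 * (1 + q%:R) / alpha.
  by rewrite divr_ge0 ?(ltW al0) // mulr_ge0 // addr_ge0.
exists (Num.truncn bnd).+1 => n nbig.
have n0 : (0 < n)%N by apply: leq_ltn_trans nbig.
split=> //; set x : R := n%:R.
have x0 : 0 < x by rewrite ltr0n.
have xb : bnd < x by apply: lt_le_trans (truncnS_gt _) _; rewrite ler_nat.
pose y := b * x.
have y0 : 0 < y by rewrite mulr_gt0.
have yb : 1 + 2 * N%:R / c < y.
  by rewrite /y [ltRHS]mulrC -ltr_pdivrMr //; apply: le_lt_trans xb; rewrite lerDl.
have cy : 2 * N%:R < c * y.
  by rewrite [ltRHS]mulrC -ltr_pdivrMr //; lra.
have ax : 2 * (1 + q%:R) <= alpha * x.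
  by rewrite [leRHS]mulrC -ler_pdivrMr // ltW //; apply: le_lt_trans xb; rewrite lerDr.
have zk0 z : 0 <= z -> 0 <= z * x / k by move=> z0; rewrite divr_ge0 ?mulr_ge0 ?(ltW k0) ?(ltW x0).
pose t := Num.truncn y; pose w := Num.truncn (2 * x / k).
pose s := Num.truncn ((1 - alpha) * x / k).
have /andP[tl tu] : t%:R <= y < t.+1%:R by apply: truncn_itv; rewrite ltW.
have /andP[wl wu] : w%:R <= 2 * x / k < w.+1%:R by apply: truncn_itv; apply: zk0.
have /andP[sl su] : s%:R <= (1 - alpha) * x / k < s.+1%:R.
  by apply: truncn_itv; apply: zk0; rewrite subr_ge0.
rewrite -natr1 in tu; rewrite -natr1 in wu; rewrite -natr1 in su.
have My : M * y = alpha * (x / k).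
  by rewrite /y /b; field; rewrite !gt_eqF.
set z := x / k in My.
have zx : x = k * z by rewrite /z mulrC divfK // gt_eqF.
have z0 : 0 < z by rewrite divr_gt0.
rewrite -mulrA -/z in wl wu; rewrite -mulrA -/z in sl su.
have Mt : M * t%:R <= alpha * z by rewrite -My ler_wpM2l // ltW.
have qw : q%:R * w%:R <= q%:R * (2 * z) by rewrite ler_wpM2l.
have t0 : (0 < t)%N by rewrite truncn_gt0; lra.
have Utw : (#|U| * t <= w)%N.
  rewrite /w truncn_ge_nat ?zk0 // natrM -/M -mulrA -/z; apply: (le_trans Mt).
  by rewrite ler_pM2r //; lra.
have size_le : (3 * (#|U| * t) + 3 * s + q * w <= n)%N.
  rewrite -(ler_nat R) !natrD !natrM -/M -/x zx kq.
  lra.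
have nE : n = (3 * (#|U| * t) + (3 * s + (n - (3 * (#|U| * t) + 3 * s + q * w))) + q * w)%N.
  by rewrite addnA [RHS]addnAC subnKC.
have [G [degG copG farG]] := exists_blowup U0 t0 Utw nE far.
exists G; split.
- move=> v; rewrite -/x.
  have kz : (k - 2) / k * x = (k - 2) * z by rewrite /z mulrAC mulrA.
  rewrite mulrBl kz; case: (degG v) => h; rewrite -(ler_nat R) natrD ?natrM in h.
    apply: le_trans h.
    have h1 : q%:R * (2 * z) - q%:R <= q%:R * w%:R.
      by rewrite -{2}[q%:R]mulr1 -mulrBr ler_wpM2l //; lra.
    (* As [k] is at least 3, the slack [alpha * x] is at least twice [alpha * z]: half of it covers
       the vertices missing from B_j, the other half the rounding. *)
    have h2 : alpha * z <= alpha * x - (1 + q%:R).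
      have : 2 * (alpha * z) <= alpha * x by rewrite mulrCA ler_pM2l // zx ler_pM2r //; lra.
      lra.
    rewrite kq; lra.
  rewrite -/x in h; have : 0 <= alpha * x by rewrite mulr_ge0 // ltW.
  move: h; rewrite {1}zx; lra.
- apply: (@le_trans _ _ (#|triangles a| * t ^ 3 * w ^ q)%:R); first by rewrite ler_nat.
  rewrite !natrM !natrX.
  apply: (@le_trans _ _ (27 * d * M ^+ 3 * y ^+ 3 * (2 * z) ^+ q)).
    have y3 : t%:R ^+ 3 <= y ^+ 3 by rewrite lerXn2r ?nnegrE ?(ltW y0).
    have wq : w%:R ^+ q <= (2 * z) ^+ q by rewrite lerXn2r ?nnegrE // mulr_ge0 // ltW.
    apply: ler_pM; rewrite ?mulr_ge0 ?exprn_ge0 //.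
    by apply: ler_pM; rewrite ?mulr_ge0.
  have d0 : 0 <= d by rewrite ltW // delta_K3_gt0.
  have -> : 27 * d * M ^+ 3 * y ^+ 3 * (2 * z) ^+ q =
      d * alpha ^+ 3 * x ^+ r * (27 * 2 ^+ q / k ^+ r).
    have -> : 27 * d * M ^+ 3 * y ^+ 3 = 27 * d * (M * y) ^+ 3 by ring.
    rewrite My /z !exprMn !exprVn (_ : r = q + 3)%N; last by rewrite addn3.
    rewrite !exprD.
    by field; rewrite expf_neq0 gt_eqF.
  have -> : alpha ^+ 3 / (r%:R / 3) ^+ r * d * x ^+ r =
      d * alpha ^+ 3 * x ^+ r * ((r%:R / 3) ^+ r)^-1 by ring.
  apply: ler_wpM2l; last exact: clique_bound_constant.
  apply: mulr_ge0; last by apply: exprn_ge0; exact: ltW.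
  by apply: mulr_ge0 => //; apply: exprn_ge0; exact: ltW.
move=> D DG hD; have := farG D DG hD; rewrite -(ler_nat R) natrM natrX; apply: lt_le_trans.
(* The scaling of [eps] in [E] is made for this identity, as [M * y = alpha * x / k]. *)
have -> : eps * x ^+ 2 = E * M ^+ 2 * y ^+ 2.
  by rewrite /E /y /b; field; rewrite !gt_eqF.
have N0 : (0 : R) <= N%:R by rewrite ler0n.
have : N%:R * (y - 1) ^+ 2 <= N%:R * t%:R ^+ 2.
  by rewrite ler_wpM2l // lerXn2r ?nnegrE //; lra.
apply: lt_le_trans.
(* Rounding [y] down costs at most [2 * N * y], which is less than the surplus [c * y ^ 2]. *)
have : 2 * N%:R * y < c * y * y by rewrite ltr_pM2r.
by rewrite /c; nra.
Qed.

Theorem theorem3p1 (R : realType) (r : nat) (alpha eps : R)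
    (r_ge3 : (3 <= r)%N) (alpha_gt0 : 0 < alpha) (alpha_le1 : alpha <= 1)
    (eps_gt0 : 0 < eps)
    (eps_small : (2 * r%:R - 3) ^+ 2 / alpha ^+ 2 * eps < 1) :
  let gamma := (2 * r%:R - 5) / (2 * r%:R - 3) - alpha in
  let bound := alpha ^+ 3 / (r%:R / 3) ^+ r
                 * delta ((2 * r%:R - 3) ^+ 2 / alpha ^+ 2 * eps) 'K_3 0 in
  (exists N : nat, forall n : nat, (N <= n)%N ->
     exists G : sgraph 'I_n,
       [/\ min_deg_ge G (gamma * n%:R),
           #|copies 'K_r G|%:R <= bound * n%:R ^+ r
         & must_delete_at_least 'K_r G (eps * n%:R ^+ 2)])
  /\ delta eps 'K_r gamma <= bound.
Proof.
move: r_ge3 eps_small.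
case: r => [|[|[|q]]] // _ eps_small gamma bound.
have [n0 farn] := far_graphs (introT andP (conj alpha_gt0 alpha_le1)) eps_gt0 eps_small.
have gE : gamma = (2 * q.+3%:R - 3 - 2) / (2 * q.+3%:R - 3) - alpha.
  by rewrite /gamma; congr (_ / _ - _); ring.
split.
  exists n0 => n /farn[_ [G [dG cG fG]]]; exists G; split=> //; first by rewrite gE.
  by move=> D DG hD; rewrite ltW // fG.
(* Were [delta] larger, the graph on [n0] vertices would have few enough copies to be made free by
   [eps * n0 ^ 2] deletions, against the strict lower bound. *)
rewrite leNgt; apply/negP => lt.
have [_ adm _] := delta_max eps 'K_(q.+3) gamma.
have [n_gt0 [G [dG cG fG]]] := farn n0 (leqnn _).
have [||D [DG cD hD]] := adm n0 G.
- apply: (le_lt_trans cG); rewrite card_ord ltr_pM2r // exprn_gt0 // ltr0n //.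
- by rewrite gE.
by have := lt_le_trans (fG D DG hD) cD; rewrite ltxx.
Qed.
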